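(* Let $\mu\in(\frac12,1)$, let $p_1<p_2$ be real numbers, and let $u_0$ be a tempered distribution on $\mathbb{R}$ satisfying Condition $(C_{[p_1,p_2],\mu})$, with $\mathcal{F}u_0(p)=(p-p_1)^{\mu-1}\tilde u(p)$ on $(p_1,p_2)$. Let $u$ be the solution of the free Schrödinger equation with initial datum $u_0$. Let $\varepsilon>0$ be such that $p_1+\varepsilon<p_2$. For $(t,x)\in(0,+\infty)\times\mathbb{R}$ with $2(p_1+\varepsilon)<\frac{x}{t}<2p_2$ define $$H(t,x,u_0):=\frac1{2\sqrt\pi}\,e^{-i\frac\pi4}\,e^{i\frac{x^2}{4t}}\,\tilde u\!\left(\frac{x}{2t}\right)\left(\frac{x}{2t}-p_1\right)^{\mu-1}.$$ Let $\delta\in(\frac12,1)$ and $$(\sigma_1,\dots,\sigma_9):=\left(\mu,\,1,\,1,\,2,\,\delta,\,\delta,\,\tfrac32,\,\delta,\,\delta\right),$$ so that $\max_{1\le k\le 9}\{-\sigma_k\}<-\frac12$. Then there exist constants $C_k(u_0,\varepsilon)\ge0$, $k=1,\dots,9$, depending only on $u_0$, $\varepsilon$ and $\delta$, such that for all $(t,x)\in(0,+\infty)\times\mathbb{R}$ with $2(p_1+\varepsilon)<\frac{x}{t}<2p_2$, $$\left|u(t,x)-H(t,x,u_0)\,t^{-\frac12}\right|\le\sum_{k=1}^9C_k(u_0,\varepsilon)\,t^{-\sigma_k}.$$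
   Context: Fourier transform: $\mathcal{F}v(p)=\int_{\mathbb{R}}v(x)e^{-ixp}\,dx$, extended to tempered distributions. Condition $(C_{[p_1,p_2],\mu})$: $\mathcal{F}u_0$ is a function vanishing on $\mathbb{R}\setminus[p_1,p_2]$, and $\mathcal{F}u_0(p)=(p-p_1)^{\mu-1}\tilde u(p)$ for $p\in(p_1,p_2)$, where $\tilde u\in\mathcal{C}^1([p_1,p_2],\mathbb{C})$, $\tilde u(p_1)\ne0$ and $\tilde u(p_2)=0$ (i.e. $\mathcal{F}u_0(p_2)=0$). The solution of $[i\partial_t+\partial_x^2]u=0$, $u(0,\cdot)=u_0$, is $u(t)=\mathcal{F}^{-1}(e^{-itp^2}\mathcal{F}u_0)$, that is, for $t>0$, $x\in\mathbb{R}$, $$u(t,x)=\frac1{2\pi}\int_{p_1}^{p_2}\mathcal{F}u_0(p)\,e^{-itp^2+ixp}\,dp .$$ *)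

(* Defs.v *)
From Stdlib Require Import Reals List.
From Coquelicot Require Import Coquelicot.
Open Scope R_scope.

Definition cis (theta : R) : C := (cos theta, sin theta).

(* Integrals of C-valued functions are improper Riemann integrals.  The
   integrands below are continuous on the open interval of integration and
   absolutely integrable, so these coincide with the Lebesgue integrals.  Both
   ends of a bounded interval are approached from inside, because
   (p - p1)^(mu - 1) is unbounded near p1. *)
Definition is_CInt (f : R -> C) (a b : R) (l : C) : Prop :=
  is_RInt_gen (V := C_R_NormedModule) f (at_right a) (at_left b) l.

Definition CInt (f : R -> C) (a b : R) : C :=
  RInt_gen (V := C_R_CompleteNormedModule) f (at_right a) (at_left b).

Definition CInt_line (f : R -> C) : C :=
  RInt_gen (V := C_R_CompleteNormedModule) f
    (Rbar_locally m_infty) (Rbar_locally p_infty).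

Definition fourier (phi : R -> C) (p : R) : C :=
  CInt_line (fun x => (phi x * cis (- (x * p)))%C).

Definition CDerive_n (f : R -> C) (k : nat) (x : R) : C :=
  (Derive_n (fun y => Re (f y)) k x, Derive_n (fun y => Im (f y)) k x).

Definition smooth (f : R -> C) : Prop :=
  forall (k : nat) (x : R),
    ex_derive_n (fun y => Re (f y)) k x /\ ex_derive_n (fun y => Im (f y)) k x.

Definition schwartz (phi : R -> C) : Prop :=
  smooth phi /\
  forall j k : nat, exists M : R,
    forall x : R, Rabs x ^ j * Cmod (CDerive_n phi k x) <= M.

(* Continuity is for the topology of the Schwartz space given by the seminorms
   sup_x |x|^j |phi^(k)(x)|.  A distribution is represented by a functional on
   all functions R -> C; its values outside the Schwartz space are irrelevant
   and unconstrained. *)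
Definition tempered_distribution (T : (R -> C) -> C) : Prop :=
  (forall (a b : C) (phi psi : R -> C), schwartz phi -> schwartz psi ->
     T (fun x => (a * phi x + b * psi x)%C) = (a * T phi + b * T psi)%C) /\
  (forall phi : R -> C, schwartz phi ->
     forall e : R, 0 < e ->
     exists (N : nat) (d : R), 0 < d /\
       forall psi : R -> C, schwartz psi ->
         (forall (j k : nat) (x : R), (j <= N)%nat -> (k <= N)%nat ->
            Rabs x ^ j * Cmod (CDerive_n (fun y => (psi y - phi y)%C) k x) <= d) ->
         Cmod (T psi - T phi)%C <= e).

Definition fourier_distribution (T : (R -> C) -> C) : (R -> C) -> C :=
  fun phi => T (fourier phi).

(* T is the regular distribution phi |-> \int_R v phi, where v is a function
   vanishing outside [a, b]. *)
Definition is_function_on (T : (R -> C) -> C) (a b : R) (v : R -> C) : Prop :=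
  (forall p : R, ~ (a <= p <= b) -> v p = RtoC 0) /\
  (forall phi : R -> C, schwartz phi ->
     is_CInt (fun p => (v p * phi p)%C) a b (T phi)).

(* C^1 on the closed interval [a, b]: the derivatives at a and b are
   one-sided, and values outside [a, b] play no role. *)
Definition C1_on (a b : R) (f : R -> C) : Prop :=
  exists df : R -> C,
    (forall p : R, a <= p <= b ->
       filterlim (fun q => (RtoC (/ (q - p)) * (f q - f p))%C)
         (within (fun q => a <= q <= b) (locally' p)) (locally (df p))) /\
    continuous_on (fun p => a <= p <= b) df.

(* Condition (C_{[p1,p2],mu}) on u0, with v = F u0 and ut = \tilde u. *)
Definition condition_C (p1 p2 mu : R) (u0 : (R -> C) -> C) (v ut : R -> C)
  : Prop :=
  is_function_on (fourier_distribution u0) p1 p2 v /\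
  (forall p : R, p1 < p < p2 -> v p = (RtoC (Rpower (p - p1) (mu - 1)) * ut p)%C) /\
  C1_on p1 p2 ut /\
  ut p1 <> RtoC 0 /\
  ut p2 = RtoC 0.

(* The free Schroedinger evolution F^{-1} (e^{-itp^2} v), for v = F u0
   supported in [p1, p2]. *)
Definition schrodinger_solution (p1 p2 : R) (v : R -> C) (t x : R) : C :=
  (RtoC (/ (2 * PI)) *
   CInt (fun p => (v p * cis (- (t * p ^ 2) + x * p))%C) p1 p2)%C.

Definition H_lead (p1 mu : R) (ut : R -> C) (t x : R) : C :=
  (RtoC (/ (2 * sqrt PI)) * cis (- (PI / 4)) * cis (x ^ 2 / (4 * t))
   * ut (x / (2 * t))%R
   * RtoC (Rpower (x / (2 * t) - p1) (mu - 1)))%C.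

Definition sigmas (mu delta : R) : list R :=
  mu :: 1 :: 1 :: 2 :: delta :: delta :: 3 / 2 :: delta :: delta :: nil.

(* 1-indexed, as in sigma_1, ..., sigma_9. *)
Definition sigma_nth (mu delta : R) (k : nat) : R :=
  nth (k - 1) (sigmas mu delta) 0.

(* Main.v *)
Require Import Defs.
From Stdlib Require Import Reals List RList Lra.
From Coquelicot Require Import Coquelicot.
Open Scope R_scope.

(** With [p0 = x / (2 t)] and [g p = (p - p1)^(mu-1) ut p], the solution is, up to a
    factor of modulus [1 / (2 PI)], the integral of [g p e^{-i t (p - p0)^2}].  Let
    [A x = int_0^x e^{-i r^2} dr], which tends to [a = sqrt PI / 2 e^{-i PI / 4}] with an
    error [O(1 / (1 + x))].  To the right (left) of [p0] the integrand is, up to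
    [g' p (A (sqrt t (p - p0)) -+ a) / sqrt t], the derivative of
    [g p (A (sqrt t (p - p0)) -+ a) / sqrt t].  The jump of the latter at [p0] is the
    leading term [2 a g p0 / sqrt t]; it vanishes at [p2] because [ut p2 = 0].  The integral
    is cut at [p1 + 1 / t]; the part on the left of the cut and the boundary term at the cut
    are [O(t^{-mu})], and the [g'] term is [O(t^{-mu} + t^{-1} ln t)] because
    [g' p = O((p - p1)^(mu-2))].  For small [t] everything is [O(t^{-2})].
    Each estimate is the mean value inequality [|F'| <= B' -> |F b - F a| <= B b - B a],
    applied to explicit [F] and [B]. *)

(** * Mean value inequalities *)

(** As [ut] is only C^1, there is one integration by parts to spend, and it breaks down at p1, where
    g' is not integrable; this forces a cut. A cut at distance d from p1 costs d^mu for the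
    discarded integral and d^(mu-1) / t for the boundary term and the singular part of the g' term;
    the two costs balance at d = 1 / t. The role of eps is to separate the singularity from the
    stationary point: left of p0, either p - p1 >= eps / 2 and g' is bounded, or p0 - p >= eps / 2
    and the Fresnel tail is O(t^(-1/2)). Nothing separates p0 from p2, so the tail bound has to stay
    finite at 0, hence C / (1 + x) instead of C / x. Its integral is a logarithm that does not blow
    up as p0 approaches p2, and t^(-1) ln t is absorbed by t^(-delta) for any delta < 1. The limit a
    comes from an identity for A^2, which leaves a sign to be determined; the sign follows from the
    positivity of the sum of the two real Fresnel integrals. *)

Lemma is_derive_continuity_pt (f : R -> R) (x l : R) :
  is_derive f x l -> continuity_pt f x.
Proof.
  intros H. apply continuity_pt_filterlim. apply (ex_derive_continuous f).
  now exists l.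
Qed.

Lemma nonneg_derive_le (f df : R -> R) (a b : R) :
  a <= b ->
  (forall x, a <= x <= b -> continuity_pt f x) ->
  (forall x, a < x < b -> is_derive f x (df x)) ->
  (forall x, a < x < b -> 0 <= df x) ->
  f a <= f b.
Proof.
  intros Hab Hc Hd Hp.
  (* [MVT_gen] may return an endpoint, where nothing is known about [df]. *)
  set (df' := fun x => if Rlt_dec a x then if Rlt_dec x b then df x else 0 else 0).
  destruct (MVT_gen f a b df') as [c [Hc1 Hc2]].
  - intros x. rewrite (Rmin_left _ _ Hab), (Rmax_right _ _ Hab). intros Hx.
    unfold df'. destruct (Rlt_dec a x); [ | lra ]. destruct (Rlt_dec x b); [ | lra ].
    now apply Hd.
  - intros x. rewrite (Rmin_left _ _ Hab), (Rmax_right _ _ Hab). apply Hc.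
  - assert (0 <= df' c).
    { unfold df'. destruct (Rlt_dec a c); [ | lra ]. destruct (Rlt_dec c b); [ | lra ].
      now apply Hp. }
    assert (0 <= df' c * (b - a)) by (apply Rmult_le_pos; lra).
    lra.
Qed.

(** Both [B + f] and [B - f] are nondecreasing. *)
Lemma abs_derive_le (f df B dB : R -> R) (a b : R) :
  a <= b ->
  (forall x, a <= x <= b -> continuity_pt f x) ->
  (forall x, a <= x <= b -> continuity_pt B x) ->
  (forall x, a < x < b -> is_derive f x (df x)) ->
  (forall x, a < x < b -> is_derive B x (dB x)) ->
  (forall x, a < x < b -> Rabs (df x) <= dB x) ->
  Rabs (f b - f a) <= B b - B a.
Proof.
  intros Hab Hcf HcB Hdf HdB Hle. apply Rabs_le. split.
  - cut (B a + f a <= B b + f b); [ lra | ].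
    apply (nonneg_derive_le (fun x => B x + f x) (fun x => dB x + df x)); auto.
    + intros x Hx. apply continuity_pt_plus; auto.
    + intros x Hx. apply (is_derive_plus (K := R_AbsRing) (V := R_NormedModule)); auto.
    + intros x Hx. specialize (Hle x Hx). apply Rabs_le_between in Hle. lra.
  - cut (B a - f a <= B b - f b); [ lra | ].
    apply (nonneg_derive_le (fun x => B x - f x) (fun x => dB x - df x)); auto.
    + intros x Hx. apply continuity_pt_minus; auto.
    + intros x Hx. apply (is_derive_minus (K := R_AbsRing) (V := R_NormedModule)); auto.
    + intros x Hx. specialize (Hle x Hx). apply Rabs_le_between in Hle. lra.
Qed.

Lemma zero_derive_const (f : R -> R) (a b : R) :
  (forall x, is_derive f x 0) -> f a = f b.
Proof.
  intros Hd.
  assert (H : forall a b, a <= b -> f a = f b).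
  { clear a b. intros a b Hab.
    assert (Rabs (f b - f a) <= 0 - 0).
    { apply (abs_derive_le f (fun _ => 0) (fun _ => 0) (fun _ => 0)); auto.
      - intros x _. apply (is_derive_continuity_pt f x 0); auto.
      - intros x _. apply continuity_pt_const. intros u w; reflexivity.
      - intros x _. apply (is_derive_const (K := R_AbsRing) (V := R_NormedModule)).
      - intros x _. rewrite Rabs_R0. lra. }
    assert (H1 := Rabs_pos (f b - f a)).
    assert (Rabs (f b - f a) = 0) by lra.
    destruct (Req_dec (f b - f a) 0) as [E|E]; [ lra | ].
    apply Rabs_no_R0 in E. lra. }
  destruct (Rle_lt_dec a b); [ auto | symmetry; apply H; lra ].
Qed.

Lemma is_derive_RInt_continuous (f : R -> R) (a x : R) :
  (forall y, continuity_pt f y) ->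
  is_derive (fun b => RInt f a b) x (f x).
Proof.
  intros Hf. apply (is_derive_RInt f (fun b => RInt f a b) a x).
  - apply filter_forall. intros b. apply (RInt_correct f).
    apply ex_RInt_continuous. intros z _. now apply continuity_pt_filterlim.
  - now apply continuity_pt_filterlim.
Qed.

(** * Fresnel integrals *)

Definition fresnel_cos (x : R) : R := RInt (fun r => cos (r ^ 2)) 0 x.
Definition fresnel_sin (x : R) : R := RInt (fun r => sin (r ^ 2)) 0 x.

Ltac derivable_continuous :=
  match goal with |- continuity_pt ?f ?x =>
    apply derivable_continuous_pt, ex_derive_Reals_0; auto_derive
  end.

Lemma is_derive_fresnel_cos (x : R) : is_derive fresnel_cos x (cos (x ^ 2)).
Proof.
  apply (is_derive_RInt_continuous (fun r => cos (r ^ 2))).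
  intros y. derivable_continuous; auto.
Qed.

Lemma is_derive_fresnel_sin (x : R) : is_derive fresnel_sin x (sin (x ^ 2)).
Proof.
  apply (is_derive_RInt_continuous (fun r => sin (r ^ 2))).
  intros y. derivable_continuous; auto.
Qed.

Lemma fresnel_cos_0 : fresnel_cos 0 = 0.
Proof. apply (RInt_point (V := R_CompleteNormedModule)). Qed.

Lemma fresnel_sin_0 : fresnel_sin 0 = 0.
Proof. apply (RInt_point (V := R_CompleteNormedModule)). Qed.

(* With [A = fresnel_cos - i fresnel_sin], the derivative of [A^2] is that of
   [i int_0^1 e^{-i x^2 (1 + y^2)} / (1 + y^2) dy], as in the classical differentiation
   proof of the Gaussian integral. *)
Definition fresnel_aux_cos (x : R) : R :=
  RInt (fun y => cos (x ^ 2 * (1 + y ^ 2)) / (1 + y ^ 2)) 0 1.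
Definition fresnel_aux_sin (x : R) : R :=
  RInt (fun y => sin (x ^ 2 * (1 + y ^ 2)) / (1 + y ^ 2)) 0 1.

Lemma one_plus_sqr_pos (y : R) : 0 < 1 + y ^ 2.
Proof. assert (H := pow2_ge_0 y). lra. Qed.

Lemma is_derive_fresnel_cos_comp (x y : R) :
  is_derive (fun z => fresnel_cos (x * z)) y (x * cos ((x * y) ^ 2)).
Proof.
  apply (is_derive_comp fresnel_cos (fun z => x * z)).
  - apply is_derive_fresnel_cos.
  - auto_derive; auto. ring.
Qed.

Lemma is_derive_fresnel_sin_comp (x y : R) :
  is_derive (fun z => fresnel_sin (x * z)) y (x * sin ((x * y) ^ 2)).
Proof.
  apply (is_derive_comp fresnel_sin (fun z => x * z)).
  - apply is_derive_fresnel_sin.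
  - auto_derive; auto. ring.
Qed.

Lemma is_derive_lin_comb (a b : R) (f g : R -> R) (x df dg : R) :
  is_derive f x df -> is_derive g x dg ->
  is_derive (fun z => a * f z + b * g z) x (a * df + b * dg).
Proof.
  intros Hf Hg. apply (is_derive_plus (fun z => a * f z) (fun z => b * g z)).
  - now apply (is_derive_scal f x a).
  - now apply (is_derive_scal g x b).
Qed.

Lemma continuity_pt_phase (x y : R) :
  continuity_pt (fun z => x ^ 2 * (1 + z ^ 2)) y.
Proof. derivable_continuous; auto. Qed.

(** The phase splits as x^2 + (x y)^2, so the addition formula exhibits the integrand as the
    y-derivative of a combination of [fresnel_sin (x * y)] and [fresnel_cos (x * y)]. *)
Lemma is_RInt_sin_phase (x : R) :
  is_RInt (fun y => x * sin (x ^ 2 * (1 + y ^ 2))) 0 1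
    (cos (x ^ 2) * fresnel_sin x + sin (x ^ 2) * fresnel_cos x).
Proof.
  replace (cos (x ^ 2) * fresnel_sin x + sin (x ^ 2) * fresnel_cos x)
    with (minus (cos (x ^ 2) * fresnel_sin (x * 1) + sin (x ^ 2) * fresnel_cos (x * 1))
       (cos (x ^ 2) * fresnel_sin (x * 0) + sin (x ^ 2) * fresnel_cos (x * 0))).
  - apply (is_RInt_derive (V := R_CompleteNormedModule)
      (fun y => cos (x ^ 2) * fresnel_sin (x * y) + sin (x ^ 2) * fresnel_cos (x * y))).
    + intros y _.
      replace (x * sin (x ^ 2 * (1 + y ^ 2))) with
        (cos (x ^ 2) * (x * sin ((x * y) ^ 2)) + sin (x ^ 2) * (x * cos ((x * y) ^ 2))).
      * apply is_derive_lin_comb;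
          [ apply is_derive_fresnel_sin_comp | apply is_derive_fresnel_cos_comp ].
      * replace (x ^ 2 * (1 + y ^ 2)) with (x ^ 2 + (x * y) ^ 2) by ring.
        rewrite sin_plus. ring.
    + intros y _. apply continuity_pt_filterlim. derivable_continuous; auto.
  - unfold minus, plus, opp; simpl. rewrite Rmult_0_r, Rmult_1_r, fresnel_cos_0, fresnel_sin_0.
    ring.
Qed.

Lemma is_RInt_cos_phase (x : R) :
  is_RInt (fun y => x * cos (x ^ 2 * (1 + y ^ 2))) 0 1
    (cos (x ^ 2) * fresnel_cos x + - sin (x ^ 2) * fresnel_sin x).
Proof.
  replace (cos (x ^ 2) * fresnel_cos x + - sin (x ^ 2) * fresnel_sin x)
    with (minus (cos (x ^ 2) * fresnel_cos (x * 1) + - sin (x ^ 2) * fresnel_sin (x * 1))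
       (cos (x ^ 2) * fresnel_cos (x * 0) + - sin (x ^ 2) * fresnel_sin (x * 0))).
  - apply (is_RInt_derive (V := R_CompleteNormedModule)
      (fun y => cos (x ^ 2) * fresnel_cos (x * y) + - sin (x ^ 2) * fresnel_sin (x * y))).
    + intros y _.
      replace (x * cos (x ^ 2 * (1 + y ^ 2))) with
        (cos (x ^ 2) * (x * cos ((x * y) ^ 2)) + - sin (x ^ 2) * (x * sin ((x * y) ^ 2))).
      * apply is_derive_lin_comb;
          [ apply is_derive_fresnel_cos_comp | apply is_derive_fresnel_sin_comp ].
      * replace (x ^ 2 * (1 + y ^ 2)) with (x ^ 2 + (x * y) ^ 2) by ring.
        rewrite cos_plus. ring.
    + intros y _. apply continuity_pt_filterlim. derivable_continuous; auto.
  - unfold minus, plus, opp; simpl. rewrite Rmult_0_r, Rmult_1_r, fresnel_cos_0, fresnel_sin_0.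
    ring.
Qed.

(** Differentiation under the integral sign: the factor 1 + y^2 from the chain rule cancels the
    denominator, which leaves an integrand with an explicit antiderivative for f = cos and f =
    sin. *)
Lemma is_derive_fresnel_aux (f df : R -> R) (x : R) :
  (forall z, is_derive f z (df z)) -> (forall z, continuity_pt df z) ->
  is_derive (fun x => RInt (fun y => f (x ^ 2 * (1 + y ^ 2)) / (1 + y ^ 2)) 0 1) x
    (RInt (fun y => 2 * x * df (x ^ 2 * (1 + y ^ 2))) 0 1).
Proof.
  intros Hf Hdf.
  assert (Hd : forall u y, is_derive (fun x => f (x ^ 2 * (1 + y ^ 2)) / (1 + y ^ 2)) u
             (2 * u * df (u ^ 2 * (1 + y ^ 2)))).
  { intros u y. assert (Hy := one_plus_sqr_pos y).
    replace (2 * u * df (u ^ 2 * (1 + y ^ 2))) with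
      ((2 * u * (1 + y ^ 2)) * df (u ^ 2 * (1 + y ^ 2)) * / (1 + y ^ 2)) by (field; lra).
    apply (is_derive_scal_l (K := R_AbsRing) (V := R_NormedModule)
             (fun x => f (x ^ 2 * (1 + y ^ 2)))).
    apply (is_derive_comp (K := R_AbsRing) (V := R_NormedModule) f
             (fun x => x ^ 2 * (1 + y ^ 2))).
    - apply Hf.
    - auto_derive; auto. ring. }
  (* [is_derive_RInt_param] gives the derivative as an integral of [Derive], so the goal is first
     put in that shape. *)
  erewrite (RInt_ext _ (fun y => Derive (fun x => f (x ^ 2 * (1 + y ^ 2)) / (1 + y ^ 2)) x)).
  2:{ intros y _. symmetry. apply is_derive_unique, Hd. }
  apply (is_derive_RInt_param (fun x y => f (x ^ 2 * (1 + y ^ 2)) / (1 + y ^ 2)) 0 1 x).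
  - apply filter_forall. intros u y _. eexists. apply Hd.
  - intros y _.
    apply (continuity_2d_pt_ext (fun u y => 2 * u * df (u ^ 2 * (1 + y ^ 2)))).
    { intros u z. symmetry. apply is_derive_unique, Hd. }
    repeat first
      [ apply continuity_2d_pt_mult | apply continuity_2d_pt_const
      | apply continuity_2d_pt_id1 | apply continuity_2d_pt_id2 ].
    apply (continuity_1d_2d_pt_comp df); [ apply Hdf | ].
    apply continuity_2d_pt_mult.
    + apply (continuity_1d_2d_pt_comp (fun u => u ^ 2));
        [ derivable_continuous; auto | apply continuity_2d_pt_id1 ].
    + apply (continuity_1d_2d_pt_comp (fun u => 1 + u ^ 2));
        [ derivable_continuous; auto | apply continuity_2d_pt_id2 ].
  - apply filter_forall. intros u. apply (ex_RInt_continuous (V := R_CompleteNormedModule)).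
    intros y _.
    apply continuity_pt_filterlim. apply continuity_pt_div.
    + apply (continuity_pt_comp (fun y => u ^ 2 * (1 + y ^ 2)) f);
        [ apply continuity_pt_phase | ].
      eapply is_derive_continuity_pt. apply Hf.
    + derivable_continuous; auto.
    + assert (Hy := one_plus_sqr_pos y). lra.
Qed.

Lemma is_derive_fresnel_aux_cos (x : R) :
  is_derive fresnel_aux_cos x
    (- 2 * (cos (x ^ 2) * fresnel_sin x + sin (x ^ 2) * fresnel_cos x)).
Proof.
  unfold fresnel_aux_cos.
  erewrite <- (is_RInt_unique (V := R_CompleteNormedModule) _ 0 1
     (- 2 * (cos (x ^ 2) * fresnel_sin x + sin (x ^ 2) * fresnel_cos x)));
    [ apply (is_derive_fresnel_aux cos (fun z => - sin z)) | ].
  - intros z. auto_derive; auto. ring.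
  - intros z. derivable_continuous; auto.
  - apply (is_RInt_ext (fun y => scal (- 2) (x * sin (x ^ 2 * (1 + y ^ 2))))).
    + intros y _. unfold scal; simpl. unfold mult; simpl. ring.
    + apply (is_RInt_scal (V := R_NormedModule)). apply is_RInt_sin_phase.
Qed.

Lemma is_derive_fresnel_aux_sin (x : R) :
  is_derive fresnel_aux_sin x
    (2 * (cos (x ^ 2) * fresnel_cos x + - sin (x ^ 2) * fresnel_sin x)).
Proof.
  unfold fresnel_aux_sin.
  erewrite <- (is_RInt_unique (V := R_CompleteNormedModule) _ 0 1
     (2 * (cos (x ^ 2) * fresnel_cos x + - sin (x ^ 2) * fresnel_sin x)));
    [ apply (is_derive_fresnel_aux sin cos) | ].
  - intros z. auto_derive; auto. ring.
  - intros z. derivable_continuous; auto.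
  - apply (is_RInt_ext (fun y => scal 2 (x * cos (x ^ 2 * (1 + y ^ 2))))).
    + intros y _. unfold scal; simpl. unfold mult; simpl. ring.
    + apply (is_RInt_scal (V := R_NormedModule)). apply is_RInt_cos_phase.
Qed.

Lemma is_derive_mult_R (f g : R -> R) (x df dg : R) :
  is_derive f x df -> is_derive g x dg ->
  is_derive (fun z => f z * g z) x (df * g x + f x * dg).
Proof.
  intros Hf Hg. apply (is_derive_mult (K := R_AbsRing) f g); auto.
  intros a b. apply Rmult_comm.
Qed.

Lemma fresnel_aux_cos_0 : fresnel_aux_cos 0 = PI / 4.
Proof.
  unfold fresnel_aux_cos. apply is_RInt_unique.
  replace (PI / 4) with (minus (atan 1) (atan 0)).
  2:{ rewrite atan_1, atan_0. unfold minus, plus, opp; simpl. ring. }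
  apply (is_RInt_ext (fun y => / (1 + y ^ 2))).
  { intros y _. replace (0 ^ 2 * (1 + y ^ 2)) with 0 by ring. rewrite cos_0.
    symmetry. apply Rmult_1_l. }
  apply (is_RInt_derive (V := R_CompleteNormedModule) atan).
  - intros y _. rewrite <- Rsqr_pow2. apply is_derive_atan.
  - intros y _. apply continuity_pt_filterlim. derivable_continuous.
    assert (Hy := one_plus_sqr_pos y). lra.
Qed.

Lemma fresnel_aux_sin_0 : fresnel_aux_sin 0 = 0.
Proof.
  unfold fresnel_aux_sin.
  rewrite (RInt_ext _ (fun _ => 0)).
  - rewrite RInt_const. unfold scal; simpl. unfold mult; simpl. ring.
  - intros y _. replace (0 ^ 2 * (1 + y ^ 2)) with 0 by ring. rewrite sin_0.
    apply Rmult_0_l.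
Qed.

(** Imaginary part of the identity for A^2: the derivatives cancel, and the constant is the value
    arctan 1 of [fresnel_aux_cos] at 0. *)
Lemma fresnel_cos_mul_sin (x : R) :
  2 * (fresnel_cos x * fresnel_sin x) = PI / 4 - fresnel_aux_cos x.
Proof.
  assert (H : 2 * (fresnel_cos x * fresnel_sin x) + 1 * fresnel_aux_cos x
            = 2 * (fresnel_cos 0 * fresnel_sin 0) + 1 * fresnel_aux_cos 0).
  { apply (zero_derive_const
      (fun x => 2 * (fresnel_cos x * fresnel_sin x) + 1 * fresnel_aux_cos x)).
    intros y. evar_last.
    - apply is_derive_lin_comb; [ apply is_derive_mult_R | ].
      + apply is_derive_fresnel_cos.
      + apply is_derive_fresnel_sin.
      + apply is_derive_fresnel_aux_cos.
    - simpl. ring. }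
  rewrite fresnel_cos_0, fresnel_aux_cos_0 in H. lra.
Qed.

(** Real part of the same identity; here the constant is 0. *)
Lemma fresnel_cos_sqr_sub_sin_sqr (x : R) :
  fresnel_cos x * fresnel_cos x - fresnel_sin x * fresnel_sin x = fresnel_aux_sin x.
Proof.
  assert (H : 1 * (1 * (fresnel_cos x * fresnel_cos x) + -1 * (fresnel_sin x * fresnel_sin x))
                + -1 * fresnel_aux_sin x
            = 1 * (1 * (fresnel_cos 0 * fresnel_cos 0) + -1 * (fresnel_sin 0 * fresnel_sin 0))
                + -1 * fresnel_aux_sin 0).
  { apply (zero_derive_const
      (fun x => 1 * (1 * (fresnel_cos x * fresnel_cos x) + -1 * (fresnel_sin x * fresnel_sin x))
                + -1 * fresnel_aux_sin x)).
    intros y. evar_last.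
    - apply is_derive_lin_comb; [ apply is_derive_lin_comb | ].
      + apply is_derive_mult_R; apply is_derive_fresnel_cos.
      + apply is_derive_mult_R; apply is_derive_fresnel_sin.
      + apply is_derive_fresnel_aux_sin.
    - simpl. ring. }
  rewrite fresnel_cos_0, fresnel_sin_0, fresnel_aux_sin_0 in H. lra.
Qed.

Lemma continuity_pt_over_one_plus_sqr (f : R -> R) (y : R) :
  continuity_pt f y -> continuity_pt (fun y => f y / (1 + y ^ 2)) y.
Proof.
  intros Hf. apply continuity_pt_div; [ exact Hf | derivable_continuous; auto | ].
  assert (Hy := one_plus_sqr_pos y). lra.
Qed.

Lemma RInt_over_one_plus_sqr_bound (f : R -> R) :
  (forall y, continuity_pt f y) -> (forall y, Rabs (f y) <= 1) ->
  Rabs (RInt (fun y => f y / (1 + y ^ 2)) 0 1) <= 1.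
Proof.
  intros Hf Hb. apply Rle_trans with ((1 - 0) * 1); [ | lra ].
  apply abs_RInt_le_const; [ lra | | ].
  - apply (ex_RInt_continuous (V := R_CompleteNormedModule)). intros y _.
    apply continuity_pt_filterlim, continuity_pt_over_one_plus_sqr, Hf.
  - intros y _. assert (Hy := pow2_ge_0 y). unfold Rdiv. rewrite Rabs_mult.
    rewrite (Rabs_pos_eq (/ (1 + y ^ 2))).
    2:{ left. apply Rinv_0_lt_compat. lra. }
    apply Rmult_le_reg_r with (1 + y ^ 2); [ lra | ].
    rewrite Rmult_assoc, Rinv_l; [ | lra ]. specialize (Hb y). nra.
Qed.

Lemma fresnel_aux_cos_bound (x : R) : Rabs (fresnel_aux_cos x) <= 1.
Proof.
  apply (RInt_over_one_plus_sqr_bound (fun y => cos (x ^ 2 * (1 + y ^ 2)))).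
  - intros y. derivable_continuous; auto.
  - intros y. apply Rabs_le, COS_bound.
Qed.

Lemma fresnel_aux_sin_bound (x : R) : Rabs (fresnel_aux_sin x) <= 1.
Proof.
  apply (RInt_over_one_plus_sqr_bound (fun y => sin (x ^ 2 * (1 + y ^ 2)))).
  - intros y. derivable_continuous; auto.
  - intros y. apply Rabs_le, SIN_bound.
Qed.

(** |A|^4 = |A^2|^2, whose two components are bounded by 1 and PI / 4 + 1 <= 2. *)
Lemma fresnel_sqr_sum_bound (x : R) :
  fresnel_cos x * fresnel_cos x + fresnel_sin x * fresnel_sin x <= 3.
Proof.
  assert (H1 := fresnel_cos_mul_sin x). assert (H2 := fresnel_cos_sqr_sub_sin_sqr x).
  assert (HP := fresnel_aux_cos_bound x). assert (HQ := fresnel_aux_sin_bound x).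
  apply Rabs_le_between in HP. apply Rabs_le_between in HQ.
  assert (HPI := PI_4). assert (HPI0 := PI_RGT_0).
  set (c := fresnel_cos x) in *. set (s := fresnel_sin x) in *.
  set (u := c * c - s * s) in *. set (w := 2 * (c * s)) in *.
  assert (E : (c * c + s * s) * (c * c + s * s) = u * u + w * w) by (unfold u, w; ring).
  assert (u * u <= 1) by nra. assert (w * w <= 4) by nra. nra.
Qed.

Lemma fresnel_cos_bound (x : R) : Rabs (fresnel_cos x) <= 2.
Proof. assert (H := fresnel_sqr_sum_bound x). apply Rabs_le. nra. Qed.

Lemma fresnel_sin_bound (x : R) : Rabs (fresnel_sin x) <= 2.
Proof. assert (H := fresnel_sqr_sum_bound x). apply Rabs_le. nra. Qed.

(* Integration by parts against the bounded antiderivative [G] of [x f]. *)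
Lemma RInt_over_one_plus_sqr_decay (f G : R -> R) (x : R) :
  0 < x ->
  (forall y, continuity_pt f y) ->
  (forall y, is_derive G y (x * f y)) ->
  G 0 = 0 ->
  (forall y, Rabs (G y) <= 4) ->
  Rabs (RInt (fun y => f y / (1 + y ^ 2)) 0 1) <= 4 / x.
Proof.
  intros Hx Hf HG HG0 HGb.
  set (N := fun b => RInt (fun y => f y / (1 + y ^ 2)) 0 b).
  assert (HN : forall y, is_derive N y (f y / (1 + y ^ 2))).
  { intros y. apply (is_derive_RInt_continuous (fun y => f y / (1 + y ^ 2))).
    intros z. apply continuity_pt_over_one_plus_sqr, Hf. }
  (* [W] is the boundary term. The derivative of [N - W] is dominated by that of [B] below, which
     increases by 2 / x on [0, 1]; together with [Rabs (W 1) <= 2 / x] this makes up the 4 / x. *)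
  set (W := fun y => G y * / (x * (1 + y ^ 2))).
  assert (HW : forall y, is_derive W y
       (x * f y * / (x * (1 + y ^ 2)) + G y * (- (2 * y) / (x * (1 + y ^ 2) ^ 2)))).
  { intros y. assert (Hy := one_plus_sqr_pos y).
    apply (is_derive_mult_R G (fun y => / (x * (1 + y ^ 2)))); [ apply HG | ].
    auto_derive.
    - apply Rmult_integral_contrapositive_currified; lra.
    - field. lra. }
  set (B := fun y => - (4 / x) * / (1 + y ^ 2)).
  assert (HB : forall y, is_derive B y (4 / x * (2 * y / (1 + y ^ 2) ^ 2))).
  { intros y. assert (Hy := one_plus_sqr_pos y). unfold B.
    auto_derive; [ lra | field; lra ]. }
  assert (HD : forall y, is_derive (fun z => 1 * N z + -1 * W z) y
       (G y * (2 * y / (x * (1 + y ^ 2) ^ 2)))).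
  { intros y. assert (Hy := one_plus_sqr_pos y). evar_last.
    - apply is_derive_lin_comb; [ apply HN | apply HW ].
    - simpl. field. lra. }
  assert (H : Rabs ((1 * N 1 + -1 * W 1) - (1 * N 0 + -1 * W 0)) <= B 1 - B 0).
  { apply (abs_derive_le (fun z => 1 * N z + -1 * W z)
       (fun y => G y * (2 * y / (x * (1 + y ^ 2) ^ 2))) B
       (fun y => 4 / x * (2 * y / (1 + y ^ 2) ^ 2))); auto; [ lra | | | ].
    - intros y _. eapply is_derive_continuity_pt. apply HD.
    - intros y _. eapply is_derive_continuity_pt. apply HB.
    - intros y Hy. assert (Hy1 := one_plus_sqr_pos y).
      rewrite Rabs_mult.
      rewrite (Rabs_pos_eq (2 * y / (x * (1 + y ^ 2) ^ 2))).
      + replace (4 / x * (2 * y / (1 + y ^ 2) ^ 2)) with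
          (4 * (2 * y / (x * (1 + y ^ 2) ^ 2))) by (field; lra).
        apply Rmult_le_compat_r; [ | apply HGb ].
        apply Rdiv_le_0_compat; [ lra | ]. apply Rmult_lt_0_compat; [ lra | ].
        apply pow_lt; lra.
      + apply Rdiv_le_0_compat; [ lra | ]. apply Rmult_lt_0_compat; [ lra | ].
        apply pow_lt; lra. }
  assert (HN0 : N 0 = 0) by apply (RInt_point (V := R_CompleteNormedModule)).
  assert (HW0 : W 0 = 0) by (unfold W; rewrite HG0; ring).
  assert (HW1 : W 1 = G 1 * (/ (2 * x))) by (unfold W; f_equal; f_equal; ring).
  assert (HB1 : B 1 - B 0 = 2 * / x) by (unfold B; field; lra).
  rewrite HN0, HW0, HB1 in H.
  assert (Hi : 0 < / x) by now apply Rinv_0_lt_compat.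
  assert (HW2 : Rabs (W 1) <= 2 * / x).
  { rewrite HW1, Rabs_mult, Rinv_mult. rewrite (Rabs_pos_eq (/ 2 * / x)) by lra.
    specialize (HGb 1). assert (H0 := Rabs_pos (G 1)). nra. }
  change (Rabs (N 1) <= 4 / x). unfold Rdiv.
  apply Rabs_le_between in H. apply Rabs_le_between in HW2. apply Rabs_le. lra.
Qed.

Lemma Rabs_trig_comb_le (a b c s : R) :
  Rabs a <= 1 -> Rabs b <= 1 -> Rabs c <= 2 -> Rabs s <= 2 ->
  Rabs (a * c + b * s) <= 4.
Proof.
  intros. eapply Rle_trans; [ apply Rabs_triang | ]. rewrite !Rabs_mult.
  assert (H3 := Rabs_pos a). assert (H4 := Rabs_pos b).
  assert (H5 := Rabs_pos c). assert (H6 := Rabs_pos s). nra.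
Qed.

Lemma Rabs_cos_le (x : R) : Rabs (cos x) <= 1.
Proof. apply Rabs_le, COS_bound. Qed.

Lemma Rabs_sin_le (x : R) : Rabs (sin x) <= 1.
Proof. apply Rabs_le, SIN_bound. Qed.

Lemma fresnel_aux_cos_decay (x : R) : 0 < x -> Rabs (fresnel_aux_cos x) <= 4 / x.
Proof.
  intros Hx.
  apply (RInt_over_one_plus_sqr_decay (fun y => cos (x ^ 2 * (1 + y ^ 2)))
    (fun y => cos (x ^ 2) * fresnel_cos (x * y) + - sin (x ^ 2) * fresnel_sin (x * y)));
    auto.
  - intros y. derivable_continuous; auto.
  - intros y. evar_last.
    + apply is_derive_lin_comb;
        [ apply is_derive_fresnel_cos_comp | apply is_derive_fresnel_sin_comp ].
    + simpl. replace (x * (x * 1) * (1 + y * (y * 1)))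
        with (x ^ 2 + (x * y) ^ 2) by ring.
      rewrite cos_plus. simpl. ring.
  - rewrite Rmult_0_r, fresnel_cos_0, fresnel_sin_0. ring.
  - intros y. apply Rabs_trig_comb_le;
      rewrite ?Rabs_Ropp; auto using Rabs_cos_le, Rabs_sin_le, fresnel_cos_bound, fresnel_sin_bound.
Qed.

Lemma fresnel_aux_sin_decay (x : R) : 0 < x -> Rabs (fresnel_aux_sin x) <= 4 / x.
Proof.
  intros Hx.
  apply (RInt_over_one_plus_sqr_decay (fun y => sin (x ^ 2 * (1 + y ^ 2)))
    (fun y => cos (x ^ 2) * fresnel_sin (x * y) + sin (x ^ 2) * fresnel_cos (x * y)));
    auto.
  - intros y. derivable_continuous; auto.
  - intros y. evar_last.
    + apply is_derive_lin_comb;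
        [ apply is_derive_fresnel_sin_comp | apply is_derive_fresnel_cos_comp ].
    + simpl. replace (x * (x * 1) * (1 + y * (y * 1)))
        with (x ^ 2 + (x * y) ^ 2) by ring.
      rewrite sin_plus. simpl. ring.
  - rewrite Rmult_0_r, fresnel_cos_0, fresnel_sin_0. ring.
  - intros y. apply Rabs_trig_comb_le;
      auto using Rabs_cos_le, Rabs_sin_le, fresnel_cos_bound, fresnel_sin_bound.
Qed.

Lemma is_derive_fresnel_sum (x : R) :
  is_derive (fun r => 1 * fresnel_cos r + 1 * fresnel_sin r) x
    (1 * cos (x ^ 2) + 1 * sin (x ^ 2)).
Proof.
  apply is_derive_lin_comb; [ apply is_derive_fresnel_cos | apply is_derive_fresnel_sin ].
Qed.

(** On [0, PI / 2] cosine and sine are nonnegative with squares summing to 1, so their sum is at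
    least 1. *)
Lemma fresnel_sum_ge_id (x : R) :
  0 <= x -> x ^ 2 <= PI / 2 -> x <= fresnel_cos x + fresnel_sin x.
Proof.
  intros Hx Hx2.
  cut ((1 * fresnel_cos 0 + 1 * fresnel_sin 0) - 0
       <= (1 * fresnel_cos x + 1 * fresnel_sin x) - x).
  { rewrite fresnel_cos_0, fresnel_sin_0. lra. }
  assert (Hd : forall r, is_derive (fun r => (1 * fresnel_cos r + 1 * fresnel_sin r) - r) r
       (1 * cos (r ^ 2) + 1 * sin (r ^ 2) - 1)).
  { intros r.
    apply (is_derive_minus (K := R_AbsRing) (V := R_NormedModule)
       (fun r => 1 * fresnel_cos r + 1 * fresnel_sin r)).
    - apply is_derive_fresnel_sum.
    - apply (is_derive_id (K := R_AbsRing)). }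
  apply (nonneg_derive_le (fun r => (1 * fresnel_cos r + 1 * fresnel_sin r) - r)
     (fun r => 1 * cos (r ^ 2) + 1 * sin (r ^ 2) - 1)); auto.
  - intros r _. eapply is_derive_continuity_pt. apply Hd.
  - intros r Hr. assert (0 <= r ^ 2 <= PI / 2).
    { split; [ apply pow2_ge_0 | ]. eapply Rle_trans; [ | exact Hx2 ].
      apply pow_incr. lra. }
    assert (Hc : 0 <= cos (r ^ 2)) by (apply cos_ge_0; lra).
    assert (Hs : 0 <= sin (r ^ 2)) by (apply sin_ge_0; lra).
    assert (E := sin2_cos2 (r ^ 2)). unfold Rsqr in E. nra.
Qed.

(* Selects the right square root of [- i PI / 4] as the limit of the Fresnel integral.
   Past [sqrt (PI / 2)], subtracting the leading oscillation leaves a monotone function. *)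
Lemma fresnel_sum_nonneg (x : R) : 0 <= x -> 0 <= fresnel_cos x + fresnel_sin x.
Proof.
  intros Hx. set (r0 := sqrt (PI / 2)).
  assert (HPI := PI2_3_2).
  assert (Hr0 : r0 ^ 2 = PI / 2).
  { unfold r0. rewrite <- Rsqr_pow2, Rsqr_sqrt; lra. }
  assert (Hr0p : 0 < r0) by (apply sqrt_lt_R0; lra).
  destruct (Rle_lt_dec x r0) as [Hle|Hlt].
  { apply Rle_trans with x; auto. apply fresnel_sum_ge_id; auto.
    rewrite <- Hr0. apply pow_incr. lra. }
  (* The fraction is the leading oscillation; the extra 1 / r adds 2 to the numerator sin - cos of
     the derivative and makes it nonnegative. *)
  set (f := fun r => (1 * fresnel_cos r + 1 * fresnel_sin r)
                     - ((sin (r ^ 2) - cos (r ^ 2)) / (2 * r) + / r)).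
  assert (Hd : forall r, 0 < r -> is_derive f r
             ((sin (r ^ 2) - cos (r ^ 2) + 2) / (2 * r ^ 2))).
  { intros r Hr. evar_last.
    - apply (is_derive_minus (K := R_AbsRing) (V := R_NormedModule)
         (fun r => 1 * fresnel_cos r + 1 * fresnel_sin r)
         (fun r => (sin (r ^ 2) - cos (r ^ 2)) / (2 * r) + / r) r).
      + apply is_derive_fresnel_sum.
      + auto_derive; [ repeat split; lra | reflexivity ].
    - unfold minus, plus, opp; simpl. field. lra. }
  assert (H : f r0 <= f x).
  { apply (nonneg_derive_le f (fun r => (sin (r ^ 2) - cos (r ^ 2) + 2) / (2 * r ^ 2))).
    - lra.
    - intros r Hr. eapply is_derive_continuity_pt, Hd. lra.
    - intros r Hr. apply Hd. lra.
    - intros r Hr. assert (Hs := SIN_bound (r ^ 2)). assert (Hc := COS_bound (r ^ 2)).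
      apply Rdiv_le_0_compat; [ lra | ].
      assert (0 < r ^ 2) by (apply pow_lt; lra). lra. }
  (* At [r0] the subtracted quantity is 3 / (2 r0), which is at most [r0] because r0^2 = PI / 2 >= 3
     / 2. *)
  assert (H0 : 0 <= f r0).
  { unfold f. rewrite Hr0, sin_PI2, cos_PI2.
    assert (H1 : r0 <= fresnel_cos r0 + fresnel_sin r0)
      by (apply fresnel_sum_ge_id; lra).
    replace ((1 - 0) / (2 * r0) + / r0) with (3 / 2 * / r0) by (field; lra).
    assert (3 / 2 * / r0 <= r0).
    { apply Rmult_le_reg_r with r0; auto. rewrite Rmult_assoc, Rinv_l by lra.
      replace (r0 * r0) with (r0 ^ 2) by ring. lra. }
    lra. }
  assert (H1 : 0 <= (sin (x ^ 2) - cos (x ^ 2)) / (2 * x) + / x).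
  { replace ((sin (x ^ 2) - cos (x ^ 2)) / (2 * x) + / x) with
      ((sin (x ^ 2) - cos (x ^ 2) + 2) / (2 * x)) by (field; lra).
    assert (Hs := SIN_bound (x ^ 2)). assert (Hc := COS_bound (x ^ 2)).
    apply Rdiv_le_0_compat; lra. }
  unfold f in H, H0. lra.
Qed.

(** Common limit of [fresnel_cos] and [fresnel_sin] at infinity: 2 c s = PI / 4, c^2 = s^2 and c + s
    >= 0 leave only c = s = sqrt (PI / 8). *)
Definition fresnel_lim : R := sqrt (PI / 8).

Lemma fresnel_lim_bounds : 0 <= fresnel_lim <= 1.
Proof.
  split; [ apply sqrt_pos | ].
  unfold fresnel_lim. rewrite <- sqrt_1. apply sqrt_le_1_alt.
  assert (HPI := PI_4). lra.
Qed.

(* With [A = c - i s] and [A0 = b - i b], [2 b^2 = PI / 4]: [|A - A0| |A + A0| = |A^2 - A0^2|],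
   and [|A + A0|] is bounded below because [c + s >= 0]. *)
Lemma fresnel_dist_sqr (x : R) :
  0 < x ->
  (fresnel_cos x - fresnel_lim) ^ 2 + (fresnel_sin x - fresnel_lim) ^ 2 <= (8 / x) ^ 2.
Proof.
  intros Hx.
  assert (H1 := fresnel_cos_mul_sin x). assert (H2 := fresnel_cos_sqr_sub_sin_sqr x).
  assert (HP := fresnel_aux_cos_decay x Hx). assert (HQ := fresnel_aux_sin_decay x Hx).
  assert (Hn : 0 <= fresnel_cos x + fresnel_sin x) by (apply fresnel_sum_nonneg; lra).
  assert (HPI := PI2_3_2).
  assert (Hb : fresnel_lim * fresnel_lim = PI / 8) by (apply sqrt_sqrt; lra).
  assert (Hb0 : 0 <= fresnel_lim) by apply sqrt_pos.
  apply Rabs_le_between in HP. apply Rabs_le_between in HQ.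
  replace (8 / x) with (2 * (4 / x)) by (field; lra).
  assert (H4 : 0 < 4 / x) by (apply Rdiv_lt_0_compat; lra).
  set (h := 4 / x) in *. set (b := fresnel_lim) in *.
  set (c := fresnel_cos x) in *. set (s := fresnel_sin x) in *.
  set (P := fresnel_aux_cos x) in *. set (Q := fresnel_aux_sin x) in *.
  set (D := (c - b) ^ 2 + (s - b) ^ 2).
  set (S := (c + b) ^ 2 + (s + b) ^ 2).
  (* Here A0^2 = - i PI / 4, so the identity for A^2 reads A^2 - A0^2 = Q + i P, while D and S are
     the squared moduli of A - A0 and A + A0. *)
  assert (E : D * S = P ^ 2 + Q ^ 2).
  { replace P with (- (2 * (c * s - b * b))) by lra.
    rewrite <- H2. unfold D, S. ring. }
  (* Since b >= 0 and c + s >= 0, S >= 2 b^2 = PI / 4. With D S <= 2 h^2 this yields D <= (2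
     h)^2. *)
  assert (HS : 3 / 4 <= S) by (unfold S; nra).
  assert (HD : 0 <= D) by (unfold D; nra).
  nra.
Qed.

Lemma Rabs_le_of_sqr (u w : R) : 0 <= w -> u ^ 2 <= w ^ 2 -> Rabs u <= w.
Proof. intros Hw H. apply Rabs_le. nra. Qed.

(** Decay for x >= 1 and plain boundedness for x < 1 are merged into one majorant, finite at 0,
    whose primitive is a logarithm. *)
Lemma fresnel_dist (x : R) :
  0 <= x ->
  Rabs (fresnel_cos x - fresnel_lim) <= 16 / (1 + x) /\
  Rabs (fresnel_sin x - fresnel_lim) <= 16 / (1 + x).
Proof.
  intros Hx. destruct (Rle_lt_dec 1 x) as [H1|H1].
  - assert (H := fresnel_dist_sqr x ltac:(lra)).
    assert (H8 : 0 < 8 / x) by (apply Rdiv_lt_0_compat; lra).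
    assert (Hle : 8 / x <= 16 / (1 + x)).
    { apply Rmult_le_reg_r with (x * (1 + x)); [ nra | ].
      replace (8 / x * (x * (1 + x))) with (8 * (1 + x)) by (field; lra).
      replace (16 / (1 + x) * (x * (1 + x))) with (16 * x) by (field; lra). lra. }
    assert (Hu := pow2_ge_0 (fresnel_cos x - fresnel_lim)).
    assert (Hw := pow2_ge_0 (fresnel_sin x - fresnel_lim)).
    split; (eapply Rle_trans; [ apply Rabs_le_of_sqr | exact Hle ]); lra.
  - assert (Hc := fresnel_cos_bound x). assert (Hs := fresnel_sin_bound x).
    assert (Hb := fresnel_lim_bounds).
    assert (H8 : 8 <= 16 / (1 + x)).
    { apply Rmult_le_reg_r with (1 + x); [ lra | ].
      replace (16 / (1 + x) * (1 + x)) with 16 by (field; lra). lra. }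
    apply Rabs_le_between in Hc. apply Rabs_le_between in Hs.
    split; (eapply Rle_trans; [ apply Rabs_le | exact H8 ]); lra.
Qed.

(** * Complex-valued functions of a real variable *)

Ltac componentwise_ring :=
  unfold scal, mult, minus, plus, opp, zero, Re, Im; simpl;
  unfold scal, mult, plus, opp, zero, Re, Im; simpl;
  match goal with |- ?a = ?b => change (@eq R a b); ring end.

(** Componentwise, so that the real mean value inequalities and [auto_derive] apply to each part. *)
Definition is_Cderive (f : R -> C) (x : R) (l : C) : Prop :=
  is_derive (fun y => Re (f y)) x (Re l) /\ is_derive (fun y => Im (f y)) x (Im l).

Definition Ccontinuity_pt (f : R -> C) (x : R) : Prop :=
  continuity_pt (fun y => Re (f y)) x /\ continuity_pt (fun y => Im (f y)) x.

Lemma is_Cderive_continuity_pt (f : R -> C) (x : R) (l : C) :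
  is_Cderive f x l -> Ccontinuity_pt f x.
Proof. intros [H1 H2]. split; eapply is_derive_continuity_pt; eassumption. Qed.

Lemma is_Cderive_minus (f g : R -> C) (x : R) (df dg : C) :
  is_Cderive f x df -> is_Cderive g x dg ->
  is_Cderive (fun y => f y - g y)%C x (df - dg)%C.
Proof.
  intros [Hf1 Hf2] [Hg1 Hg2]; split.
  - apply (is_derive_minus (K := R_AbsRing) (V := R_NormedModule)
      (fun y => Re (f y)) (fun y => Re (g y))); assumption.
  - apply (is_derive_minus (K := R_AbsRing) (V := R_NormedModule)
      (fun y => Im (f y)) (fun y => Im (g y))); assumption.
Qed.

Lemma is_Cderive_mult (f g : R -> C) (x : R) (df dg : C) :
  is_Cderive f x df -> is_Cderive g x dg ->
  is_Cderive (fun y => f y * g y)%C x (df * g x + f x * dg)%C.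
Proof.
  intros [Hf1 Hf2] [Hg1 Hg2]; split.
  - evar_last.
    + apply (is_derive_minus (K := R_AbsRing) (V := R_NormedModule)
        (fun y => Re (f y) * Re (g y)) (fun y => Im (f y) * Im (g y)));
        apply is_derive_mult_R; eassumption.
    + componentwise_ring.
  - evar_last.
    + apply (is_derive_plus (K := R_AbsRing) (V := R_NormedModule)
        (fun y => Re (f y) * Im (g y)) (fun y => Im (f y) * Re (g y)));
        apply is_derive_mult_R; eassumption.
    + componentwise_ring.
Qed.

Lemma is_Cderive_const (c : C) (x : R) : is_Cderive (fun _ => c) x 0%C.
Proof.
  split;
    [ change (is_derive (fun _ : R => Re c) x 0)
    | change (is_derive (fun _ : R => Im c) x 0) ];
    apply (is_derive_const (K := R_AbsRing) (V := R_NormedModule)).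
Qed.

Lemma is_Cderive_RtoC (f : R -> R) (x l : R) :
  is_derive f x l -> is_Cderive (fun y => RtoC (f y)) x (RtoC l).
Proof.
  intros H; split; [ exact H | ].
  change (is_derive (fun _ : R => 0) x 0).
  apply (is_derive_const (K := R_AbsRing) (V := R_NormedModule)).
Qed.

Lemma is_Cderive_cis (th : R -> R) (x l : R) :
  is_derive th x l ->
  is_Cderive (fun y => cis (th y)) x (Ci * RtoC l * cis (th x))%C.
Proof.
  intros H; split; simpl.
  - evar_last.
    + apply (is_derive_comp cos th); [ | exact H ]. auto_derive; [ auto | reflexivity ].
    + componentwise_ring.
  - evar_last.
    + apply (is_derive_comp sin th); [ | exact H ]. auto_derive; [ auto | reflexivity ].
    + componentwise_ring.
Qed.

Lemma Ccontinuity_pt_mult (f g : R -> C) (x : R) :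
  Ccontinuity_pt f x -> Ccontinuity_pt g x -> Ccontinuity_pt (fun y => f y * g y)%C x.
Proof.
  intros [Hf1 Hf2] [Hg1 Hg2]; split.
  - apply (continuity_pt_minus (fun y => Re (f y) * Re (g y)) (fun y => Im (f y) * Im (g y)));
      apply continuity_pt_mult; assumption.
  - apply (continuity_pt_plus (fun y => Re (f y) * Im (g y)) (fun y => Im (f y) * Re (g y)));
      apply continuity_pt_mult; assumption.
Qed.

Lemma Ccontinuity_pt_plus (f g : R -> C) (x : R) :
  Ccontinuity_pt f x -> Ccontinuity_pt g x -> Ccontinuity_pt (fun y => f y + g y)%C x.
Proof.
  intros [Hf1 Hf2] [Hg1 Hg2]; split.
  - apply (continuity_pt_plus (fun y => Re (f y)) (fun y => Re (g y))); assumption.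
  - apply (continuity_pt_plus (fun y => Im (f y)) (fun y => Im (g y))); assumption.
Qed.

Lemma Ccontinuity_pt_minus (f g : R -> C) (x : R) :
  Ccontinuity_pt f x -> Ccontinuity_pt g x -> Ccontinuity_pt (fun y => f y - g y)%C x.
Proof.
  intros [Hf1 Hf2] [Hg1 Hg2]; split.
  - apply (continuity_pt_minus (fun y => Re (f y)) (fun y => Re (g y))); assumption.
  - apply (continuity_pt_minus (fun y => Im (f y)) (fun y => Im (g y))); assumption.
Qed.

Lemma Ccontinuity_pt_RtoC (f : R -> R) (x : R) :
  continuity_pt f x -> Ccontinuity_pt (fun y => RtoC (f y)) x.
Proof.
  intros H; split; [ exact H | ]. apply continuity_pt_const. intros u w; reflexivity.
Qed.

Lemma Cmod_cis (x : R) : Cmod (cis x) = 1.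
Proof.
  assert (H := sin2_cos2 x). unfold Rsqr in H.
  unfold Cmod, cis. simpl. etransitivity; [ | exact sqrt_1 ]. f_equal. lra.
Qed.

Lemma Cmod_sqr (z : C) : Cmod z * Cmod z = Re z * Re z + Im z * Im z.
Proof.
  unfold Cmod. rewrite sqrt_sqrt; [ unfold Re, Im; ring | ].
  apply Rplus_le_le_0_compat; apply pow2_ge_0.
Qed.

Lemma Rabs_scalar_product_le (w z : C) :
  Rabs (Re w * Re z + Im w * Im z) <= Cmod w * Cmod z.
Proof.
  assert (Hw := Cmod_sqr w). assert (Hz := Cmod_sqr z).
  apply Rabs_le_of_sqr.
  - apply Rmult_le_pos; apply Cmod_ge_0.
  - replace ((Cmod w * Cmod z) ^ 2) with ((Cmod w * Cmod w) * (Cmod z * Cmod z)) by ring.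
    rewrite Hw, Hz. assert (H := pow2_ge_0 (Re w * Im z - Im w * Re z)). nra.
Qed.

(* Project on the direction of [F b - F a] to reduce to the real case. *)
Lemma Cmod_derive_le (F dF : R -> C) (B dB : R -> R) (a b : R) :
  a <= b ->
  (forall x, a <= x <= b -> Ccontinuity_pt F x) ->
  (forall x, a <= x <= b -> continuity_pt B x) ->
  (forall x, a < x < b -> is_Cderive F x (dF x)) ->
  (forall x, a < x < b -> is_derive B x (dB x)) ->
  (forall x, a < x < b -> Cmod (dF x) <= dB x) ->
  Cmod (F b - F a)%C <= B b - B a.
Proof.
  intros Hab HcF HcB HdF HdB Hle.
  set (w := (F b - F a)%C). set (m := Cmod w).
  assert (HB : B a <= B b).
  { apply (nonneg_derive_le B dB); auto. intros x Hx.
    eapply Rle_trans; [ apply Cmod_ge_0 | apply Hle, Hx ]. }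
  assert (Hm : 0 <= m) by apply Cmod_ge_0.
  assert (H : Rabs ((Re w * Re (F b) + Im w * Im (F b)) - (Re w * Re (F a) + Im w * Im (F a)))
              <= m * B b - m * B a).
  { apply (abs_derive_le (fun x => Re w * Re (F x) + Im w * Im (F x))
      (fun x => Re w * Re (dF x) + Im w * Im (dF x))
      (fun x => m * B x) (fun x => m * dB x)); auto.
    - intros x Hx. destruct (HcF x Hx). apply continuity_pt_plus;
        apply continuity_pt_mult; auto; apply continuity_pt_const; intros u z; reflexivity.
    - intros x Hx. apply continuity_pt_mult; auto.
      apply continuity_pt_const; intros u z; reflexivity.
    - intros x Hx. destruct (HdF x Hx). now apply is_derive_lin_comb.
    - intros x Hx. now apply (is_derive_scal B x m), HdB.
    - intros x Hx. eapply Rle_trans; [ apply Rabs_scalar_product_le | ].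
      apply Rmult_le_compat_l; auto. }
  assert (Hsq := Cmod_sqr w). fold m in Hsq.
  replace (Re w * Re (F b) + Im w * Im (F b) - (Re w * Re (F a) + Im w * Im (F a)))
    with (m * m) in H.
  2:{ rewrite Hsq. unfold w. destruct (F a), (F b); simpl. ring. }
  rewrite Rabs_pos_eq in H by nra.
  (* At this point m^2 <= m (B b - B a): cancel m, or use [HB] when m = 0. *)
  destruct (Req_dec m 0); nra.
Qed.

(** * Extension of C^1 functions from an interval to the line *)

Definition clamp (a b x : R) : R := Rmax a (Rmin b x).

Lemma clamp_in (a b x : R) : a <= b -> a <= clamp a b x <= b.
Proof. intros H. unfold clamp, Rmax, Rmin. repeat destruct Rle_dec; lra. Qed.

Lemma clamp_id (a b x : R) : a <= x <= b -> clamp a b x = x.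
Proof. intros H. unfold clamp, Rmax, Rmin. repeat destruct Rle_dec; lra. Qed.

Lemma clamp_dist (a b x y : R) : a <= b -> Rabs (clamp a b y - clamp a b x) <= Rabs (y - x).
Proof.
  intros H. unfold clamp, Rmax, Rmin, Rabs.
  repeat destruct Rle_dec; repeat destruct Rcase_abs; lra.
Qed.

(** [U] is the primitive of the derivative frozen outside [a, b]. On [a, b] the difference u - U is
    continuous and has zero derivative in the interior, so it keeps its value 0 at a. One-sided
    derivatives disappear from the rest of the proof. *)
Lemma C1_extension_R (a b : R) (u du : R -> R) :
  a < b ->
  (forall p, a <= p <= b -> forall e, 0 < e -> exists d, 0 < d /\
     forall q, a <= q <= b -> q <> p -> Rabs (q - p) < d ->
       Rabs (/ (q - p) * (u q - u p) - du p) < e) ->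
  (forall x, continuity_pt (fun y => du (clamp a b y)) x) ->
  exists U : R -> R, (forall x, is_derive U x (du (clamp a b x))) /\
    (forall x, a <= x <= b -> U x = u x).
Proof.
  intros Hab Hq Hc.
  set (U := fun x => u a + RInt (fun y => du (clamp a b y)) a x).
  assert (HU : forall x, is_derive U x (du (clamp a b x))).
  { intros x. unfold U. evar_last.
    - apply (is_derive_plus (K := R_AbsRing) (V := R_NormedModule) (fun _ => u a)).
      + apply (is_derive_const (K := R_AbsRing) (V := R_NormedModule)).
      + apply (is_derive_RInt_continuous (fun y => du (clamp a b y))). exact Hc.
    - componentwise_ring. }
  exists U. split; [ exact HU | ].
  (* Clamping makes continuity at a and b two-sided. Near x the difference quotient is bounded by
     [L], so u is Lipschitz at x with constant [L]. *)
  assert (Huc : forall x, a <= x <= b -> continuity_pt (fun y => u (clamp a b y)) x).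
  { intros x Hx e He. destruct (Hq x Hx 1 Rlt_0_1) as [d [Hd Hd2]].
    set (L := Rabs (du x) + 1).
    assert (HL : 0 < L) by (unfold L; assert (H := Rabs_pos (du x)); lra).
    exists (Rmin d (e / L)). split.
    { apply Rmin_pos; auto. now apply Rdiv_lt_0_compat. }
    intros y [_ Hy]. simpl in Hy |- *. unfold Rdist in *.
    assert (Hz : Rabs (clamp a b y - x) < Rmin d (e / L)).
    { eapply Rle_lt_trans; [ | exact Hy ].
      rewrite <- (clamp_id a b x Hx) at 1. apply clamp_dist; lra. }
    rewrite (clamp_id a b x Hx).
    assert (Hz1 := clamp_in a b y ltac:(lra)).
    set (z := clamp a b y) in *.
    destruct (Req_dec z x) as [->|Hzx].
    { rewrite Rminus_diag, Rabs_R0. exact He. }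
    assert (Hz2 := Rlt_le_trans _ _ _ Hz (Rmin_l _ _)).
    assert (Hz3 := Rlt_le_trans _ _ _ Hz (Rmin_r _ _)).
    specialize (Hd2 z Hz1 Hzx Hz2).
    assert (Hqb : Rabs (/ (z - x) * (u z - u x)) <= L).
    { unfold L. replace (/ (z - x) * (u z - u x))
        with (du x + (/ (z - x) * (u z - u x) - du x)) by ring.
      eapply Rle_trans; [ apply Rabs_triang | ]. lra. }
    replace (u z - u x) with ((z - x) * (/ (z - x) * (u z - u x))) by (field; lra).
    rewrite Rabs_mult. apply Rle_lt_trans with (Rabs (z - x) * L).
    { apply Rmult_le_compat_l; [ apply Rabs_pos | exact Hqb ]. }
    apply Rmult_lt_reg_r with (/ L); [ now apply Rinv_0_lt_compat | ].
    rewrite Rmult_assoc, Rinv_r by lra. unfold Rdiv in Hz3. lra. }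
  assert (Hud : forall x, a < x < b -> is_derive (fun y => u (clamp a b y)) x (du x)).
  { intros x Hx. apply is_derive_Reals. intros e He.
    destruct (Hq x ltac:(lra) e He) as [d [Hd Hd2]].
    assert (Hd' : 0 < Rmin d (Rmin (x - a) (b - x))) by (repeat apply Rmin_pos; lra).
    exists (mkposreal _ Hd'). intros h Hh Hhd. simpl in Hhd.
    assert (H1 := Rlt_le_trans _ _ _ Hhd (Rmin_l _ _)).
    assert (H2 := Rlt_le_trans _ _ _ Hhd (Rmin_r _ _)).
    assert (H3 := Rlt_le_trans _ _ _ H2 (Rmin_l _ _)).
    assert (H4 := Rlt_le_trans _ _ _ H2 (Rmin_r _ _)).
    apply Rabs_def2 in H3. apply Rabs_def2 in H4.
    rewrite !clamp_id by lra.
    replace ((u (x + h) - u x) / h) with (/ (x + h - x) * (u (x + h) - u x)).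
    2:{ replace (x + h - x) with h by ring. unfold Rdiv. ring. }
    apply Hd2; [ lra | lra | ]. replace (x + h - x) with h by ring. exact H1. }
  intros x Hx.
  assert (H : Rabs ((u (clamp a b x) - U x) - (u (clamp a b a) - U a)) <= 0 - 0).
  { apply (abs_derive_le (fun y => u (clamp a b y) - U y) (fun _ => 0)
      (fun _ => 0) (fun _ => 0)); [ lra | | | | | ].
    - intros y Hy. apply continuity_pt_minus; [ apply Huc; lra | ].
      eapply is_derive_continuity_pt, HU.
    - intros y _. apply continuity_pt_const. intros s t; reflexivity.
    - intros y Hy. evar_last.
      + apply (is_derive_minus (K := R_AbsRing) (V := R_NormedModule)
          (fun y => u (clamp a b y)) U); [ apply Hud; lra | apply HU ].
      + rewrite clamp_id by lra. componentwise_ring.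
    - intros y _. apply (is_derive_const (K := R_AbsRing) (V := R_NormedModule)).
    - intros y _. rewrite Rabs_R0. lra. }
  rewrite !clamp_id in H by lra.
  assert (HUa : U a = u a).
  { unfold U. rewrite RInt_point. apply Rplus_0_r. }
  rewrite HUa in H. apply Rabs_le_between in H. lra.
Qed.

Lemma filterlim_clamp (a b x : R) :
  a <= b ->
  filterlim (clamp a b) (locally x) (within (fun q => a <= q <= b) (locally (clamp a b x))).
Proof.
  intros Hab P [e He]. exists e. intros y Hy. apply He; [ | now apply clamp_in ].
  eapply Rle_lt_trans; [ apply (clamp_dist a b x y Hab) | exact Hy ].
Qed.

Lemma C1_on_extension (a b : R) (f : R -> C) :
  a < b -> C1_on a b f ->
  exists U dU : R -> C,
    (forall x, is_Cderive U x (dU x)) /\ (forall x, Ccontinuity_pt dU x) /\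
    (forall x, a <= x <= b -> U x = f x).
Proof.
  intros Hab [df [Hd Hc]].
  assert (Hcc : forall x, filterlim (fun y => df (clamp a b y)) (locally x)
                            (locally (df (clamp a b x)))).
  { intros x. eapply filterlim_comp; [ apply filterlim_clamp; lra | ].
    apply Hc. apply clamp_in; lra. }
  assert (Hq : forall p, a <= p <= b -> forall e, 0 < e -> exists d, 0 < d /\
     forall q, a <= q <= b -> q <> p -> Rabs (q - p) < d ->
       Rabs (/ (q - p) * (Re (f q) - Re (f p)) - Re (df p)) < e /\
       Rabs (/ (q - p) * (Im (f q) - Im (f p)) - Im (df p)) < e).
  { intros p Hp e He.
    assert (HP : locally (df p) (fun z => Rabs (Re z - Re (df p)) < e /\
                                          Rabs (Im z - Im (df p)) < e)).
    { exists (mkposreal e He). intros z [H1 H2]. split; [ apply H1 | apply H2 ]. }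
    destruct (Hd p Hp _ HP) as [d Hd2].
    exists d. split; [ apply cond_pos | ]. intros q Hq1 Hq2 Hq3.
    specialize (Hd2 q Hq3 Hq2 Hq1). simpl in Hd2.
    destruct Hd2 as [H1 H2].
    change (Rabs ((/ (q - p) * (Re (f q) - Re (f p)) - 0 * (Im (f q) - Im (f p))) - Re (df p)) < e)
      in H1.
    change (Rabs ((/ (q - p) * (Im (f q) - Im (f p)) + 0 * (Re (f q) - Re (f p))) - Im (df p)) < e)
      in H2.
    rewrite Rmult_0_l, Rminus_0_r in H1. rewrite Rmult_0_l, Rplus_0_r in H2.
    now split. }
  destruct (C1_extension_R a b (fun y => Re (f y)) (fun y => Re (df y)) Hab)
    as [U1 [HU1 HU1']].
  { intros p Hp e He. destruct (Hq p Hp e He) as [d [Hd1 Hd2]].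
    exists d. split; auto. intros q H1 H2 H3. apply Hd2; auto. }
  { intros x. apply continuity_pt_filterlim.
    eapply filterlim_comp; [ apply Hcc | ].
    destruct (df (clamp a b x)) as [z1 z2]. apply (continuous_fst z1 z2). }
  destruct (C1_extension_R a b (fun y => Im (f y)) (fun y => Im (df y)) Hab)
    as [U2 [HU2 HU2']].
  { intros p Hp e He. destruct (Hq p Hp e He) as [d [Hd1 Hd2]].
    exists d. split; auto. intros q H1 H2 H3. apply Hd2; auto. }
  { intros x. apply continuity_pt_filterlim.
    eapply filterlim_comp; [ apply Hcc | ].
    destruct (df (clamp a b x)) as [z1 z2]. apply (continuous_snd z1 z2). }
  exists (fun x => (U1 x, U2 x)), (fun x => df (clamp a b x)). split; [ | split ].
  - intros x. split; simpl; auto.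
  - intros x. split; apply continuity_pt_filterlim;
      (eapply filterlim_comp; [ apply Hcc | ]);
      destruct (df (clamp a b x)) as [z1 z2];
      [ apply (continuous_fst z1 z2) | apply (continuous_snd z1 z2) ].
  - intros x Hx. rewrite HU1', HU2' by auto. symmetry. apply surjective_pairing.
Qed.

(** * Improper integrals from antiderivatives *)

(** The integral over [x, y] inside (a, b) is [F y - F x], and continuity of [F] at a and b alone
    gives the limit; thus [f0] may blow up at the ends, as the integrand of the solution does at
    p1. *)
Lemma is_CInt_derive (f f0 F : R -> C) (a b : R) :
  a < b ->
  Ccontinuity_pt F a -> Ccontinuity_pt F b ->
  (forall x, a < x < b -> is_Cderive F x (f0 x)) ->
  (forall x, a < x < b -> Ccontinuity_pt f0 x) ->
  (forall x, a < x < b -> f x = f0 x) ->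
  is_CInt f a b (F b - F a)%C.
Proof.
  intros Hab [Ha1 Ha2] [Hb1 Hb2] Hd Hc Hf P [e He].
  assert (He2 : 0 < e / 2) by (assert (H := cond_pos e); lra).
  assert (Hn : forall (g : R -> R) x, continuity_pt g x ->
            locally x (fun y => Rabs (g y - g x) < e / 2)).
  { intros g x Hg. apply continuity_pt_filterlim in Hg.
    apply (Hg (fun z => Rabs (z - g x) < e / 2)).
    exists (mkposreal _ He2). intros z Hz. exact Hz. }
  (* The midpoint keeps the two moving endpoints ordered, x < m < y. *)
  set (m := (a + b) / 2).
  apply (Filter_prod _ _ _
    (fun x => a < x < m /\ Rabs (Re (F x) - Re (F a)) < e / 2 /\
              Rabs (Im (F x) - Im (F a)) < e / 2)
    (fun x => m < x < b /\ Rabs (Re (F x) - Re (F b)) < e / 2 /\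
              Rabs (Im (F x) - Im (F b)) < e / 2)).
  - unfold at_right, within.
    assert (Hl : locally a (fun x => x < m)) by (apply open_lt; unfold m; lra).
    generalize (filter_and _ _ Hl (filter_and _ _ (Hn _ _ Ha1) (Hn _ _ Ha2))).
    apply filter_imp. intros x H Hx. tauto.
  - unfold at_left, within.
    assert (Hl : locally b (fun x => m < x)) by (apply open_gt; unfold m; lra).
    generalize (filter_and _ _ Hl (filter_and _ _ (Hn _ _ Hb1) (Hn _ _ Hb2))).
    apply filter_imp. intros x H Hx. tauto.
  - intros x y [Hx [Hx1 Hx2]] [Hy [Hy1 Hy2]]. simpl.
    exists (F y - F x)%C. split.
    + apply (is_RInt_ext f0).
      { intros z. rewrite Rmin_left, Rmax_right by lra. intros Hz.
        symmetry. apply Hf. lra. }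
      apply (is_RInt_fct_extend_pair (U := R_NormedModule) (V := R_NormedModule)
               f0 x y (Re (F y) - Re (F x)) (Im (F y) - Im (F x))).
      * apply (is_RInt_derive (V := R_CompleteNormedModule) (fun z => Re (F z))
                 (fun z => Re (f0 z)));
          intros z; rewrite Rmin_left, Rmax_right by lra; intros Hz.
        -- apply Hd. lra.
        -- apply continuity_pt_filterlim. apply Hc. lra.
      * apply (is_RInt_derive (V := R_CompleteNormedModule) (fun z => Im (F z))
                 (fun z => Im (f0 z)));
          intros z; rewrite Rmin_left, Rmax_right by lra; intros Hz.
        -- apply Hd. lra.
        -- apply continuity_pt_filterlim. apply Hc. lra.
    + apply He.
      apply Rabs_def2 in Hx1. apply Rabs_def2 in Hx2.
      apply Rabs_def2 in Hy1. apply Rabs_def2 in Hy2.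
      split; apply Rabs_def1; unfold minus, plus, opp; simpl; unfold Re, Im in *; lra.
Qed.

Lemma CInt_derive (f f0 F : R -> C) (a b : R) :
  a < b ->
  Ccontinuity_pt F a -> Ccontinuity_pt F b ->
  (forall x, a < x < b -> is_Cderive F x (f0 x)) ->
  (forall x, a < x < b -> Ccontinuity_pt f0 x) ->
  (forall x, a < x < b -> f x = f0 x) ->
  CInt f a b = (F b - F a)%C.
Proof.
  intros Hab Ha Hb Hd Hc Hf.
  apply (is_RInt_gen_unique (V := C_R_CompleteNormedModule)).
  exact (is_CInt_derive f f0 F a b Hab Ha Hb Hd Hc Hf).
Qed.

(** * Stationary phase *)

(* The case split is needed because [Rpower 0 mu = exp (mu * ln 0) = 1]. *)
Definition power_primitive (mu x : R) : R :=
  if Rle_dec x 0 then 0 else Rpower x mu / mu.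

Lemma power_primitive_pos (mu x : R) : 0 < x -> power_primitive mu x = Rpower x mu / mu.
Proof. intros H. unfold power_primitive. destruct (Rle_dec x 0); [ lra | reflexivity ]. Qed.

Lemma power_primitive_0 (mu : R) : power_primitive mu 0 = 0.
Proof. unfold power_primitive. destruct (Rle_dec 0 0); [ reflexivity | lra ]. Qed.

Lemma Rpower_pos (x y : R) : 0 < Rpower x y.
Proof. apply exp_pos. Qed.

Lemma is_derive_Rpower_shift (a m x : R) :
  a < x -> is_derive (fun y => Rpower (y - a) m) x (m * Rpower (x - a) (m - 1)).
Proof.
  intros Hx. evar_last.
  - apply (is_derive_comp (fun z => Rpower z m) (fun y => y - a)).
    + apply is_derive_Reals. apply derivable_pt_lim_power. lra.
    + auto_derive; [ auto | reflexivity ].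
  - componentwise_ring.
Qed.

Lemma is_derive_power_primitive (mu a x : R) :
  0 < mu -> a < x ->
  is_derive (fun y => power_primitive mu (y - a)) x (Rpower (x - a) (mu - 1)).
Proof.
  intros Hmu Hx.
  apply (is_derive_ext_loc (fun y => / mu * Rpower (y - a) mu)).
  - apply (filter_imp (fun y => a < y)); [ | now apply open_gt ].
    intros y Hy. rewrite power_primitive_pos by lra. apply Rmult_comm.
  - evar_last.
    + apply (is_derive_scal (fun y => Rpower (y - a) mu) x (/ mu)).
      apply is_derive_Rpower_shift, Hx.
    + unfold mult; simpl. field. lra.
Qed.

Lemma continuity_pt_power_primitive (mu a x : R) :
  0 < mu -> continuity_pt (fun y => power_primitive mu (y - a)) x.
Proof.
  intros Hmu. destruct (Rlt_le_dec a x) as [H|H].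
  { eapply is_derive_continuity_pt. now apply is_derive_power_primitive. }
  (* [d] solves d^mu / mu = e. To the left of a the function vanishes, so only y with 0 < y - a < d
     matter. *)
  intros e He. set (d := Rpower (mu * e) (/ mu)).
  exists d. split; [ apply Rpower_pos | ].
  intros y [_ Hy]. simpl in Hy |- *. unfold Rdist in *.
  assert (Hx : power_primitive mu (x - a) = 0).
  { unfold power_primitive. destruct (Rle_dec (x - a) 0); lra. }
  rewrite Hx, Rminus_0_r. unfold power_primitive.
  destruct (Rle_dec (y - a) 0) as [Hya|Hya]; [ now rewrite Rabs_R0 | ].
  apply Rabs_def2 in Hy.
  rewrite Rabs_pos_eq.
  2:{ apply Rdiv_le_0_compat; [ left; apply Rpower_pos | exact Hmu ]. }
  apply Rmult_lt_reg_r with mu; [ exact Hmu | ].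
  unfold Rdiv. rewrite Rmult_assoc, Rinv_l, Rmult_1_r by lra.
  apply Rlt_le_trans with (Rpower d mu).
  - apply Rlt_Rpower_l; lra.
  - unfold d. rewrite Rpower_mult, Rinv_l, Rpower_1 by nra. lra.
Qed.

Lemma Rpower_antitone (x y m : R) : 0 < x <= y -> m <= 0 -> Rpower y m <= Rpower x m.
Proof.
  intros H Hm. replace m with (- (- m)) by ring. rewrite (Rpower_Ropp y), (Rpower_Ropp x).
  apply Rinv_le_contravar; [ apply Rpower_pos | ]. apply Rle_Rpower_l; lra.
Qed.

Lemma ln_le_Rpower (x m : R) : 0 < x -> 0 < m -> ln x <= Rpower x m / m.
Proof.
  intros Hx Hm. apply Rmult_le_reg_r with m; [ exact Hm | ].
  unfold Rdiv. rewrite Rmult_assoc, Rinv_l, Rmult_1_r by lra.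
  unfold Rpower. assert (H := exp_ineq1_le (m * ln x)). lra.
Qed.

Lemma Ccontinuous_bounded (f : R -> C) (a b : R) :
  a <= b -> (forall x, a <= x <= b -> Ccontinuity_pt f x) ->
  exists M, 0 <= M /\ forall x, a <= x <= b -> Cmod (f x) <= M.
Proof.
  intros Hab Hf.
  destruct (continuity_ab_maj (fun x => Re (f x) * Re (f x) + Im (f x) * Im (f x)) a b Hab)
    as [m [Hm _]].
  { intros x Hx. destruct (Hf x Hx).
    apply continuity_pt_plus; apply continuity_pt_mult; assumption. }
  exists (Cmod (f m)). split; [ apply Cmod_ge_0 | ]. intros x Hx.
  specialize (Hm x Hx). rewrite <- !Cmod_sqr in Hm.
  assert (H1 := Cmod_ge_0 (f x)). assert (H2 := Cmod_ge_0 (f m)). nra.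
Qed.

(** The function A of the overview; [fresnel_C_lim] is its limit a. *)
Definition fresnel (x : R) : C := (fresnel_cos x, - fresnel_sin x).
Definition fresnel_C_lim : C := (fresnel_lim, - fresnel_lim).

Lemma is_Cderive_fresnel (x : R) : is_Cderive fresnel x (cis (- (x ^ 2))).
Proof.
  split; simpl.
  - rewrite cos_neg. apply is_derive_fresnel_cos.
  - rewrite sin_neg. apply (is_derive_opp (K := R_AbsRing) (V := R_NormedModule) fresnel_sin).
    apply is_derive_fresnel_sin.
Qed.

(** The integrand is even, so the sums below have zero derivative. This carries the tail bound from
    the right of the stationary point to the left. *)
Lemma fresnel_opp (x : R) : fresnel (- x) = (- fresnel x)%C.
Proof.
  assert (Hc : forall y, is_derive (fun z => fresnel_cos (-1 * z)) y (-1 * cos ((-1 * y) ^ 2)))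
    by (intros y; apply is_derive_fresnel_cos_comp).
  assert (Hs : forall y, is_derive (fun z => fresnel_sin (-1 * z)) y (-1 * sin ((-1 * y) ^ 2)))
    by (intros y; apply is_derive_fresnel_sin_comp).
  assert (Hsq : forall y, (-1 * y) ^ 2 = y ^ 2) by (intros y; ring).
  assert (Ec : 1 * fresnel_cos (-1 * x) + 1 * fresnel_cos x
             = 1 * fresnel_cos (-1 * 0) + 1 * fresnel_cos 0).
  { apply (zero_derive_const (fun x => 1 * fresnel_cos (-1 * x) + 1 * fresnel_cos x)).
    intros y. evar_last.
    - apply is_derive_lin_comb; [ apply Hc | apply is_derive_fresnel_cos ].
    - rewrite Hsq. componentwise_ring. }
  assert (Es : 1 * fresnel_sin (-1 * x) + 1 * fresnel_sin x
             = 1 * fresnel_sin (-1 * 0) + 1 * fresnel_sin 0).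
  { apply (zero_derive_const (fun x => 1 * fresnel_sin (-1 * x) + 1 * fresnel_sin x)).
    intros y. evar_last.
    - apply is_derive_lin_comb; [ apply Hs | apply is_derive_fresnel_sin ].
    - rewrite Hsq. componentwise_ring. }
  replace (-1 * 0) with 0 in Ec, Es by ring. replace (-1 * x) with (- x) in Ec, Es by ring.
  rewrite fresnel_cos_0 in Ec. rewrite fresnel_sin_0 in Es.
  unfold fresnel, Copp; simpl. f_equal; lra.
Qed.

Lemma Cmod_le_Rabs_sum (z : C) : Cmod z <= Rabs (Re z) + Rabs (Im z).
Proof.
  assert (H := Cmod_sqr z). assert (H0 := Cmod_ge_0 z).
  assert (H1 := Rabs_pos (Re z)). assert (H2 := Rabs_pos (Im z)).
  assert (E1 : Re z * Re z = Rabs (Re z) * Rabs (Re z))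
    by (rewrite <- Rabs_mult, Rabs_pos_eq; nra).
  assert (E2 : Im z * Im z = Rabs (Im z) * Rabs (Im z))
    by (rewrite <- Rabs_mult, Rabs_pos_eq; nra).
  nra.
Qed.

Lemma fresnel_tail_right (x : R) :
  0 <= x -> Cmod (fresnel x - fresnel_C_lim) <= 32 / (1 + x).
Proof.
  intros Hx. destruct (fresnel_dist x Hx) as [H1 H2].
  eapply Rle_trans; [ apply Cmod_le_Rabs_sum | ]. simpl.
  replace (- fresnel_sin x + - - fresnel_lim) with (- (fresnel_sin x - fresnel_lim)) by ring.
  rewrite Rabs_Ropp. change (fresnel_cos x + - fresnel_lim) with (fresnel_cos x - fresnel_lim).
  unfold Rdiv in *. lra.
Qed.

Lemma fresnel_tail_left (x : R) :
  x <= 0 -> Cmod (fresnel x - - fresnel_C_lim) <= 32 / (1 - x).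
Proof.
  intros Hx. assert (H := fresnel_tail_right (- x) ltac:(lra)).
  rewrite fresnel_opp in H.
  replace (fresnel x - - fresnel_C_lim)%C with (- (- fresnel x - fresnel_C_lim))%C by ring.
  rewrite Cmod_opp. exact H.
Qed.

Lemma fresnel_0 : fresnel 0 = 0%C.
Proof.
  unfold fresnel. rewrite fresnel_cos_0, fresnel_sin_0, Ropp_0. reflexivity.
Qed.

(** The jump 2 a in the polar form displayed by [H_lead]. *)
Lemma fresnel_C_lim_polar :
  (2 * fresnel_C_lim)%C = (RtoC (sqrt PI) * cis (- (PI / 4)))%C.
Proof.
  assert (HPI := PI_RGT_0).
  assert (H : 2 * fresnel_lim = sqrt PI * (1 / sqrt 2)).
  { unfold fresnel_lim. replace (PI / 8) with (PI * / 8) by reflexivity.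
    rewrite sqrt_mult_alt by lra. rewrite sqrt_inv.
    replace 8 with (4 * 2) by ring. rewrite sqrt_mult_alt by lra.
    replace 4 with (2 * 2) at 1 by ring. rewrite sqrt_square by lra.
    assert (H2 : sqrt 2 <> 0) by (apply Rgt_not_eq, sqrt_lt_R0; lra).
    field. exact H2. }
  unfold fresnel_C_lim, cis, Cmult, RtoC; simpl.
  rewrite cos_neg, sin_neg, cos_PI4, sin_PI4. f_equal; lra.
Qed.

Lemma fresnel_C_lim_bound : Cmod fresnel_C_lim <= 2.
Proof.
  assert (H := fresnel_lim_bounds).
  eapply Rle_trans; [ apply Cmod_le_Rabs_sum | ]. simpl.
  rewrite Rabs_Ropp, Rabs_pos_eq; lra.
Qed.

(** For any constant [c], the second factor is a primitive of the oscillating exponential, so the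
    product reproduces the integrand up to a term in g'. The choice of c as a or -a makes that term
    decay away from p0 on the corresponding side. *)
Lemma is_Cderive_corrector (g : R -> C) (dg c : C) (s p0 p : R) :
  0 < s ->
  is_Cderive g p dg ->
  is_Cderive (fun y => g y * ((fresnel (s * (y - p0)) - c) * RtoC (/ s)))%C p
    (dg * ((fresnel (s * (p - p0)) - c) * RtoC (/ s))
     + g p * cis (- ((s * (p - p0)) ^ 2)))%C.
Proof.
  intros Hs Hg. apply is_Cderive_mult; [ exact Hg | ].
  assert (Hf : is_Cderive (fun y => fresnel (s * (y - p0))) p
                 (RtoC s * cis (- ((s * (p - p0)) ^ 2)))%C).
  { destruct (is_Cderive_fresnel (s * (p - p0))) as [H1 H2].
    assert (Hl : is_derive (fun y => s * (y - p0)) p s) by (auto_derive; [ auto | ring ]).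
    split.
    - evar_last.
      + apply (is_derive_comp (fun z => Re (fresnel z)) (fun y => s * (y - p0)));
          [ exact H1 | exact Hl ].
      + componentwise_ring.
    - evar_last.
      + apply (is_derive_comp (fun z => Im (fresnel z)) (fun y => s * (y - p0)));
          [ exact H2 | exact Hl ].
      + componentwise_ring. }
  assert (Hm := is_Cderive_mult _ _ _ _ _
    (is_Cderive_minus _ _ _ _ _ Hf (is_Cderive_const c p)) (is_Cderive_const (RtoC (/ s)) p)).
  replace (cis (- ((s * (p - p0)) ^ 2))) with
    ((RtoC s * cis (- ((s * (p - p0)) ^ 2)) - 0) * RtoC (/ s)
      + (fresnel (s * (p - p0)) - c) * 0)%C; [ exact Hm | ].
  rewrite RtoC_inv by lra. field. intros E. apply RtoC_inj in E. lra.
Qed.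

Lemma is_Cderive_singular (mu p1 : R) (U : R -> C) (dU : C) (p : R) :
  p1 < p ->
  is_Cderive U p dU ->
  is_Cderive (fun y => RtoC (Rpower (y - p1) (mu - 1)) * U y)%C p
    (RtoC ((mu - 1) * Rpower (p - p1) (mu - 2)) * U p
     + RtoC (Rpower (p - p1) (mu - 1)) * dU)%C.
Proof.
  intros Hp HU.
  apply (is_Cderive_mult (fun y => RtoC (Rpower (y - p1) (mu - 1))) U); [ | exact HU ].
  apply (is_Cderive_RtoC (fun y => Rpower (y - p1) (mu - 1))).
  replace (mu - 2) with (mu - 1 - 1) by ring.
  now apply is_derive_Rpower_shift.
Qed.

(** In the second term one factor p - p1 is split off and bounded by p2 - p1; in the first, |mu - 1|
    <= 1. *)
Lemma singular_derive_bound (mu p1 p2 M0 M1 p : R) (u du : C) :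
  0 < mu < 1 -> p1 < p <= p2 -> Cmod u <= M0 -> Cmod du <= M1 ->
  Cmod (RtoC ((mu - 1) * Rpower (p - p1) (mu - 2)) * u
     + RtoC (Rpower (p - p1) (mu - 1)) * du)%C
  <= (M0 + M1 * (p2 - p1)) * Rpower (p - p1) (mu - 2).
Proof.
  intros Hmu Hp Hu Hdu.
  replace (mu - 1) with (1 + (mu - 2)) at 2 by ring.
  rewrite Rpower_plus, Rpower_1 by lra.
  assert (Hr := Rpower_pos (p - p1) (mu - 2)).
  set (r := Rpower (p - p1) (mu - 2)) in *.
  eapply Rle_trans; [ apply Cmod_triangle | ]. rewrite !Cmod_mult, !Cmod_R.
  rewrite (Rabs_left1 ((mu - 1) * r)) by nra. rewrite (Rabs_pos_eq ((p - p1) * r)) by nra.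
  assert (H0 := Cmod_ge_0 u). assert (H1 := Cmod_ge_0 du).
  assert (Ha : - ((mu - 1) * r) * Cmod u <= M0 * r).
  { apply Rle_trans with (r * Cmod u).
    - apply Rmult_le_compat_r; [ exact H0 | nra ].
    - rewrite Rmult_comm. apply Rmult_le_compat_r; lra. }
  assert (Hb : (p - p1) * r * Cmod du <= M1 * (p2 - p1) * r).
  { replace ((p - p1) * r * Cmod du) with (((p - p1) * Cmod du) * r) by ring.
    apply Rmult_le_compat_r; [ lra | ]. rewrite (Rmult_comm M1).
    apply Rmult_le_compat; lra. }
  lra.
Qed.

(** Pure size estimate without oscillation, since the singularity is integrable. It serves up to the
    cut for large t and on the whole interval for small t. *)
Lemma near_singularity_bound (mu p1 p2 M0 q : R) (F f : R -> C) :
  0 < mu -> p1 <= q <= p2 ->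
  (forall p, p1 <= p <= p2 -> Ccontinuity_pt F p) ->
  (forall p, p1 < p < p2 -> is_Cderive F p (RtoC (Rpower (p - p1) (mu - 1)) * f p)%C) ->
  (forall p, p1 <= p <= p2 -> Cmod (f p) <= M0) ->
  Cmod (F q - F p1)%C <= M0 * power_primitive mu (q - p1).
Proof.
  intros Hmu Hq HcF HdF Hf.
  replace (M0 * power_primitive mu (q - p1)) with
    (M0 * power_primitive mu (q - p1) - M0 * power_primitive mu (p1 - p1)).
  2:{ rewrite Rminus_diag, power_primitive_0. ring. }
  apply (Cmod_derive_le F (fun p => RtoC (Rpower (p - p1) (mu - 1)) * f p)%C
    (fun p => M0 * power_primitive mu (p - p1))
    (fun p => M0 * Rpower (p - p1) (mu - 1))); [ lra | | | | | ].
  - intros p Hp. apply HcF. lra.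
  - intros p _. apply continuity_pt_mult; [ | now apply continuity_pt_power_primitive ].
    apply continuity_pt_const. intros u w; reflexivity.
  - intros p Hp. apply HdF. lra.
  - intros p Hp. apply (is_derive_scal (fun y => power_primitive mu (y - p1)) p M0).
    apply is_derive_power_primitive; lra.
  - intros p Hp. rewrite Cmod_mult, Cmod_R.
    rewrite Rabs_pos_eq by (left; apply Rpower_pos). rewrite Rmult_comm.
    apply Rmult_le_compat_r; [ left; apply Rpower_pos | apply Hf; lra ].
Qed.

Lemma is_derive_log_right (a s p0 p : R) :
  0 < s -> p0 <= p ->
  is_derive (fun y => a * ln (1 + s * (y - p0))) p (a * s / (1 + s * (p - p0))).
Proof.
  intros Hs Hp. assert (H : 0 < 1 + s * (p - p0)) by nra.
  auto_derive; [ exact H | ]. unfold Rdiv, Rminus. ring.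
Qed.

Lemma is_derive_log_left (a s p0 p : R) :
  0 < s -> p <= p0 ->
  is_derive (fun y => - a * ln (1 + s * (p0 - y))) p (a * s / (1 + s * (p0 - p))).
Proof.
  intros Hs Hp. assert (H : 0 < 1 + s * (p0 - p)) by nra.
  auto_derive; [ exact H | ]. unfold Rdiv, Rminus. ring.
Qed.

(* [s] is [sqrt t] from here on. *)
Lemma right_of_stationary_bound (p0 p2 s N : R) (F g dg : R -> C) :
  0 < s -> p0 <= p2 -> 0 <= N ->
  (forall p, p0 <= p <= p2 -> is_Cderive F p (g p * cis (- ((s * (p - p0)) ^ 2)))%C) ->
  (forall p, p0 <= p <= p2 -> is_Cderive g p (dg p)) ->
  (forall p, p0 <= p <= p2 -> Cmod (dg p) <= N) ->
  Cmod ((F p2 - g p2 * ((fresnel (s * (p2 - p0)) - fresnel_C_lim) * RtoC (/ s)))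
        - (F p0 - g p0 * ((fresnel (s * (p0 - p0)) - fresnel_C_lim) * RtoC (/ s))))%C
  <= 32 * N / s ^ 2 * ln (1 + s * (p2 - p0)).
Proof.
  intros Hs Hp HN HF Hg Hdg.
  replace (32 * N / s ^ 2 * ln (1 + s * (p2 - p0))) with
    (32 * N / s ^ 2 * ln (1 + s * (p2 - p0)) - 32 * N / s ^ 2 * ln (1 + s * (p0 - p0))).
  2:{ rewrite Rminus_diag, Rmult_0_r, Rplus_0_r, ln_1. ring. }
  (* The oscillating terms cancel and only the g' term is left. Bounded by N times the Fresnel tail
     over s, it is dominated by the derivative of the logarithm. *)
  assert (HD : forall p, p0 <= p <= p2 -> is_Cderive
    (fun y => F y - g y * ((fresnel (s * (y - p0)) - fresnel_C_lim) * RtoC (/ s)))%C p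
    (- (dg p * ((fresnel (s * (p - p0)) - fresnel_C_lim) * RtoC (/ s))))%C).
  { intros p Hp1. assert (H := is_Cderive_minus _ _ _ _ _ (HF p Hp1)
      (is_Cderive_corrector g (dg p) fresnel_C_lim s p0 p Hs (Hg p Hp1))).
    match type of H with is_Cderive _ _ ?l =>
      match goal with |- is_Cderive _ _ ?l' => replace l' with l by ring end end.
    exact H. }
  apply (Cmod_derive_le
    (fun y => F y - g y * ((fresnel (s * (y - p0)) - fresnel_C_lim) * RtoC (/ s)))%C
    (fun p => - (dg p * ((fresnel (s * (p - p0)) - fresnel_C_lim) * RtoC (/ s))))%C
    (fun p => 32 * N / s ^ 2 * ln (1 + s * (p - p0)))
    (fun p => 32 * N / s ^ 2 * s / (1 + s * (p - p0)))); auto.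
  - intros p Hp1. eapply is_Cderive_continuity_pt, HD, Hp1.
  - intros p Hp1. eapply is_derive_continuity_pt, is_derive_log_right; lra.
  - intros p Hp1. apply HD. lra.
  - intros p Hp1. apply is_derive_log_right; lra.
  - intros p Hp1. assert (Hx : 0 <= s * (p - p0)) by nra.
    assert (He := fresnel_tail_right _ Hx). assert (Hd := Hdg p ltac:(lra)).
    assert (Hi : 0 < / s) by now apply Rinv_0_lt_compat.
    rewrite Cmod_opp, !Cmod_mult, Cmod_R, Rabs_pos_eq by lra.
    replace (32 * N / s ^ 2 * s / (1 + s * (p - p0))) with
      (N * (32 / (1 + s * (p - p0)) * / s)) by (field; lra).
    apply Rmult_le_compat; try apply Cmod_ge_0; auto.
    + apply Rmult_le_pos; [ apply Cmod_ge_0 | lra ].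
    + apply Rmult_le_compat_r; lra.
Qed.

(** Split at p1 + eps / 2. Beyond it, g' is at most G (eps / 2)^(mu-2) and the tail integrates to
    the logarithm. Before it, p0 - p >= eps / 2 turns tail over s into 64 / (eps s^2), and (p -
    p1)^(mu-2) integrates to the power mu - 1 at q. The majorant [B] is the sum of both primitives,
    so a single mean value inequality covers [q, p0]. *)
Lemma left_of_stationary_bound (mu p1 p0 q eps s G : R) (F g dg : R -> C) :
  0 < mu < 1 -> 0 < s -> 0 < eps -> p1 < q <= p0 -> p1 + eps <= p0 -> 0 <= G ->
  (forall p, q <= p <= p0 -> is_Cderive F p (g p * cis (- ((s * (p - p0)) ^ 2)))%C) ->
  (forall p, q <= p <= p0 -> is_Cderive g p (dg p)) ->
  (forall p, q <= p <= p0 -> Cmod (dg p) <= G * Rpower (p - p1) (mu - 2)) ->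
  Cmod ((F p0 - g p0 * ((fresnel (s * (p0 - p0)) - - fresnel_C_lim) * RtoC (/ s)))
        - (F q - g q * ((fresnel (s * (q - p0)) - - fresnel_C_lim) * RtoC (/ s))))%C
  <= 32 * (G * Rpower (eps / 2) (mu - 2)) / s ^ 2 * ln (1 + s * (p0 - q))
     + 64 * G / (eps * (1 - mu) * s ^ 2) * Rpower (q - p1) (mu - 1).
Proof.
  intros Hmu Hs Heps Hq Hp0 HG HF Hg Hdg.
  set (kappa := Rpower (eps / 2) (mu - 2)).
  assert (Hk : 0 < kappa) by apply Rpower_pos.
  assert (Hs2 : 0 < s ^ 2) by (apply pow_lt; lra).
  set (a := 32 * (G * kappa) / s ^ 2).
  set (b := 64 * G / (eps * (1 - mu) * s ^ 2)).
  assert (Hb : 0 <= b).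
  { apply Rdiv_le_0_compat; [ lra | ]. apply Rmult_lt_0_compat; [ | lra ].
    apply Rmult_lt_0_compat; lra. }
  set (B := fun p => - a * ln (1 + s * (p0 - p)) + - b * Rpower (p - p1) (mu - 1)).
  set (dB := fun p => a * s / (1 + s * (p0 - p))
                      + - b * ((mu - 1) * Rpower (p - p1) (mu - 1 - 1))).
  assert (HB : forall p, q <= p <= p0 -> is_derive B p (dB p)).
  { intros p Hp. apply (is_derive_plus (K := R_AbsRing) (V := R_NormedModule)
      (fun p => - a * ln (1 + s * (p0 - p))) (fun p => - b * Rpower (p - p1) (mu - 1))).
    - apply is_derive_log_left; lra.
    - apply (is_derive_scal (fun p => Rpower (p - p1) (mu - 1)) p (- b)).
      apply is_derive_Rpower_shift. lra. }
  assert (HD : forall p, q <= p <= p0 -> is_Cderive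
    (fun y => F y - g y * ((fresnel (s * (y - p0)) - - fresnel_C_lim) * RtoC (/ s)))%C p
    (- (dg p * ((fresnel (s * (p - p0)) - - fresnel_C_lim) * RtoC (/ s))))%C).
  { intros p Hp1. assert (H := is_Cderive_minus _ _ _ _ _ (HF p Hp1)
      (is_Cderive_corrector g (dg p) (- fresnel_C_lim)%C s p0 p Hs (Hg p Hp1))).
    match type of H with is_Cderive _ _ ?l =>
      match goal with |- is_Cderive _ _ ?l' => replace l' with l by ring end end.
    exact H. }
  apply Rle_trans with (B p0 - B q).
  (* The power term of [B p0] is nonpositive and is dropped. *)
  2:{ unfold B. rewrite Rminus_diag, Rmult_0_r, Rplus_0_r, ln_1.
      assert (H := Rpower_pos (p0 - p1) (mu - 1)). nra. }
  apply (Cmod_derive_le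
    (fun y => F y - g y * ((fresnel (s * (y - p0)) - - fresnel_C_lim) * RtoC (/ s)))%C
    (fun p => - (dg p * ((fresnel (s * (p - p0)) - - fresnel_C_lim) * RtoC (/ s))))%C B dB);
    [ lra | | | | | ].
  - intros p Hp1. eapply is_Cderive_continuity_pt, HD, Hp1.
  - intros p Hp1. eapply is_derive_continuity_pt, HB, Hp1.
  - intros p Hp1. apply HD. lra.
  - intros p Hp1. apply HB. lra.
  - intros p Hp1. assert (Hx : s * (p - p0) <= 0) by nra.
    assert (He := fresnel_tail_left _ Hx). assert (Hd := Hdg p ltac:(lra)).
    assert (Hi : 0 < / s) by now apply Rinv_0_lt_compat.
    assert (Hy : 0 <= s * (p0 - p)) by nra.
    replace (1 - s * (p - p0)) with (1 + s * (p0 - p)) in He by ring.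
    rewrite Cmod_opp, !Cmod_mult, Cmod_R, Rabs_pos_eq by lra.
    assert (Hr := Rpower_pos (p - p1) (mu - 2)).
    set (r := Rpower (p - p1) (mu - 2)) in *.
    assert (HdB : dB p = a * s / (1 + s * (p0 - p)) + 64 * G / (eps * s ^ 2) * r).
    { unfold dB, b. replace (mu - 1 - 1) with (mu - 2) by ring. fold r. field.
      repeat split; lra. }
    rewrite HdB. apply Rle_trans with (G * r * (32 / (1 + s * (p0 - p)) * / s)).
    { apply Rmult_le_compat; try apply Cmod_ge_0; auto.
      - apply Rmult_le_pos; [ apply Cmod_ge_0 | lra ].
      - apply Rmult_le_compat_r; lra. }
    destruct (Rle_lt_dec (p1 + eps / 2) p) as [Hfar|Hnear].
    + assert (Hrk : r <= kappa) by (apply Rpower_antitone; lra).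
      apply Rle_trans with (a * s / (1 + s * (p0 - p))).
      * replace (a * s / (1 + s * (p0 - p))) with (G * kappa * (32 / (1 + s * (p0 - p)) * / s))
          by (unfold a; field; lra).
        apply Rmult_le_compat_r.
        -- apply Rmult_le_pos; [ | lra ]. apply Rdiv_le_0_compat; lra.
        -- now apply Rmult_le_compat_l.
      * assert (0 <= 64 * G / (eps * s ^ 2) * r); [ | lra ].
        apply Rmult_le_pos; [ | lra ]. apply Rdiv_le_0_compat; [ lra | ].
        now apply Rmult_lt_0_compat.
    + assert (Hle : 32 / (1 + s * (p0 - p)) * / s <= 64 / (eps * s ^ 2)).
      { replace (64 / (eps * s ^ 2)) with (32 / (s * (eps / 2)) * / s) by (field; lra).
        apply Rmult_le_compat_r; [ lra | ].
        apply Rmult_le_compat_l; [ lra | ].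
        apply Rinv_le_contravar; [ apply Rmult_lt_0_compat; lra | nra ]. }
      assert (H0 : 0 <= a * s / (1 + s * (p0 - p))).
      { apply Rdiv_le_0_compat; [ | lra ]. apply Rmult_le_pos; [ | lra ].
        apply Rdiv_le_0_compat; [ | exact Hs2 ]. apply Rmult_le_pos; [ lra | ].
        apply Rmult_le_pos; lra. }
      assert (H1 : G * r * (32 / (1 + s * (p0 - p)) * / s) <= G * r * (64 / (eps * s ^ 2))).
      { apply Rmult_le_compat_l; [ apply Rmult_le_pos; lra | exact Hle ]. }
      replace (64 * G / (eps * s ^ 2) * r) with (G * r * (64 / (eps * s ^ 2)))
        by (field; lra).
      lra.
Qed.

(** * Antiderivatives of the singular integrand *)

(** Integration by parts with the continuous primitive phi of the singular factor: phi k minus the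
    integral of phi k'. Both parts are continuous across p1, so no improper integral is needed to
    define [F]. *)
Lemma singular_antiderivative (mu p1 : R) (k dk : R -> C) :
  0 < mu ->
  (forall p, is_Cderive k p (dk p)) -> (forall p, Ccontinuity_pt dk p) ->
  exists F : R -> C, (forall p, Ccontinuity_pt F p) /\
    (forall p, p1 < p -> is_Cderive F p (RtoC (Rpower (p - p1) (mu - 1)) * k p)%C).
Proof.
  intros Hmu Hk Hdk.
  set (phi := fun p => power_primitive mu (p - p1)).
  assert (Hphi : forall p, continuity_pt phi p)
    by (intros p; now apply continuity_pt_power_primitive).
  set (I := fun p => (RInt (fun y => phi y * Re (dk y)) p1 p,
                      RInt (fun y => phi y * Im (dk y)) p1 p) : C).
  assert (HI : forall p, is_Cderive I p (RtoC (phi p) * dk p)%C).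
  { intros p. split.
    - evar_last.
      + apply (is_derive_RInt_continuous (fun y => phi y * Re (dk y))).
        intros y. apply continuity_pt_mult; [ apply Hphi | apply Hdk ].
      + componentwise_ring.
    - evar_last.
      + apply (is_derive_RInt_continuous (fun y => phi y * Im (dk y))).
        intros y. apply continuity_pt_mult; [ apply Hphi | apply Hdk ].
      + componentwise_ring. }
  exists (fun p => RtoC (phi p) * k p - I p)%C. split.
  - intros p. apply Ccontinuity_pt_minus.
    + apply (Ccontinuity_pt_mult (fun p => RtoC (phi p)) k).
      * apply Ccontinuity_pt_RtoC, Hphi.
      * eapply is_Cderive_continuity_pt, Hk.
    + eapply is_Cderive_continuity_pt, HI.
  - intros p Hp.
    assert (H : is_Cderive (fun p => RtoC (phi p)) p (RtoC (Rpower (p - p1) (mu - 1)))).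
    { apply (is_Cderive_RtoC phi). now apply is_derive_power_primitive. }
    assert (H1 := is_Cderive_minus _ _ _ _ _ (is_Cderive_mult _ _ _ _ _ H (Hk p)) (HI p)).
    match type of H1 with is_Cderive _ _ ?l =>
      match goal with |- is_Cderive _ _ ?l' => replace l' with l by ring end end.
    exact H1.
Qed.

Lemma is_Cderive_oscillating (U : R -> C) (dU : C) (s p0 p : R) :
  is_Cderive U p dU ->
  is_Cderive (fun y => U y * cis (- ((s * (y - p0)) ^ 2)))%C p
    (dU * cis (- ((s * (p - p0)) ^ 2))
     + U p * (Ci * RtoC (- (2 * s ^ 2 * (p - p0))) * cis (- ((s * (p - p0)) ^ 2))))%C.
Proof.
  intros HU.
  apply (is_Cderive_mult U (fun y => cis (- ((s * (y - p0)) ^ 2)))); [ exact HU | ].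
  apply (is_Cderive_cis (fun y => - ((s * (y - p0)) ^ 2))).
  auto_derive; [ auto | ring ].
Qed.

Lemma Ccontinuity_pt_cis (th : R -> R) (x : R) :
  continuity_pt th x -> Ccontinuity_pt (fun y => cis (th y)) x.
Proof.
  intros H. split.
  - apply (continuity_pt_comp th cos); [ exact H | derivable_continuous; auto ].
  - apply (continuity_pt_comp th sin); [ exact H | derivable_continuous; auto ].
Qed.

Lemma oscillating_antiderivative (mu p1 s p0 : R) (U dU : R -> C) :
  0 < mu ->
  (forall p, is_Cderive U p (dU p)) -> (forall p, Ccontinuity_pt dU p) ->
  exists F : R -> C, (forall p, Ccontinuity_pt F p) /\
    (forall p, p1 < p -> is_Cderive F p
       (RtoC (Rpower (p - p1) (mu - 1)) * (U p * cis (- ((s * (p - p0)) ^ 2))))%C).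
Proof.
  intros Hmu HU HdU.
  apply (singular_antiderivative mu p1 (fun p => U p * cis (- ((s * (p - p0)) ^ 2)))%C
    (fun p => dU p * cis (- ((s * (p - p0)) ^ 2))
     + U p * (Ci * RtoC (- (2 * s ^ 2 * (p - p0))) * cis (- ((s * (p - p0)) ^ 2))))%C); auto.
  - intros p. apply is_Cderive_oscillating, HU.
  - intros p.
    assert (Hc : Ccontinuity_pt (fun p => cis (- ((s * (p - p0)) ^ 2))) p).
    { apply (Ccontinuity_pt_cis (fun y => - ((s * (y - p0)) ^ 2))).
      derivable_continuous; auto. }
    apply (Ccontinuity_pt_plus (fun p => dU p * cis (- ((s * (p - p0)) ^ 2)))%C
      (fun p => U p * (Ci * RtoC (- (2 * s ^ 2 * (p - p0))) * cis (- ((s * (p - p0)) ^ 2))))%C).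
    + apply Ccontinuity_pt_mult; [ apply HdU | exact Hc ].
    + apply (Ccontinuity_pt_mult U); [ eapply is_Cderive_continuity_pt, HU | ].
      apply (Ccontinuity_pt_mult (fun p => Ci * RtoC (- (2 * s ^ 2 * (p - p0))))%C);
        [ | exact Hc ].
      apply (Ccontinuity_pt_mult (fun _ => Ci) (fun p => RtoC (- (2 * s ^ 2 * (p - p0))))).
      * eapply is_Cderive_continuity_pt, is_Cderive_const.
      * apply (Ccontinuity_pt_RtoC (fun p => - (2 * s ^ 2 * (p - p0)))).
        derivable_continuous; auto.
Qed.

(** [F] plays the role of the integral and q is the still free cut. The bound on q gives p0 - q >=
    eps / 2. *)
Lemma stationary_phase_bound (mu p1 p2 p0 q eps s M0 M1 : R) (U dU F : R -> C) :
  0 < mu < 1 -> 0 < s -> 0 < eps -> p1 < q <= p1 + eps / 2 -> p1 + eps < p0 < p2 ->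
  (forall p, is_Cderive U p (dU p)) ->
  (forall p, p1 <= p <= p2 -> Cmod (U p) <= M0) ->
  (forall p, p1 <= p <= p2 -> Cmod (dU p) <= M1) ->
  U p2 = 0%C ->
  (forall p, Ccontinuity_pt F p) ->
  (forall p, p1 < p -> is_Cderive F p
       (RtoC (Rpower (p - p1) (mu - 1)) * (U p * cis (- ((s * (p - p0)) ^ 2))))%C) ->
  let G := M0 + M1 * (p2 - p1) in
  Cmod ((F p2 - F p1)
        - 2 * fresnel_C_lim * (RtoC (Rpower (p0 - p1) (mu - 1)) * U p0) * RtoC (/ s))%C
  <= 64 * (G * Rpower (eps / 2) (mu - 2)) / s ^ 2 * ln (1 + s * (p2 - p1))
     + (64 * G / (eps * (1 - mu)) + 64 * M0 / eps) * (Rpower (q - p1) (mu - 1) / s ^ 2)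
     + M0 * power_primitive mu (q - p1).
Proof.
  intros Hmu Hs Heps Hq Hp0 HU HM0 HM1 HU2 HcF HdF G.
  assert (HM0p : 0 <= M0) by (eapply Rle_trans; [ apply Cmod_ge_0 | apply (HM0 p1); lra ]).
  assert (HM1p : 0 <= M1) by (eapply Rle_trans; [ apply Cmod_ge_0 | apply (HM1 p1); lra ]).
  assert (HG : 0 <= G) by (unfold G; nra).
  assert (Hs2 : 0 < s ^ 2) by (apply pow_lt; lra).
  set (kappa := Rpower (eps / 2) (mu - 2)).
  assert (Hkap : 0 < kappa) by apply Rpower_pos.
  set (g := fun p => (RtoC (Rpower (p - p1) (mu - 1)) * U p)%C).
  set (dg := fun p => (RtoC ((mu - 1) * Rpower (p - p1) (mu - 2)) * U p
     + RtoC (Rpower (p - p1) (mu - 1)) * dU p)%C).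
  assert (Hg : forall p, p1 < p -> is_Cderive g p (dg p))
    by (intros p Hp; apply is_Cderive_singular; auto).
  assert (Hdg : forall p, p1 < p <= p2 -> Cmod (dg p) <= G * Rpower (p - p1) (mu - 2)).
  { intros p Hp. apply singular_derive_bound; auto; [ apply HM0 | apply HM1 ]; lra. }
  assert (HdF' : forall p, p1 < p -> is_Cderive F p (g p * cis (- ((s * (p - p0)) ^ 2)))%C).
  { intros p Hp. unfold g. rewrite <- Cmult_assoc. now apply HdF. }
  (* Right of p0 the distance to p1 exceeds eps, so the bound [G * kappa] for g' away from p1 is
     valid there too. *)
  assert (HR := right_of_stationary_bound p0 p2 s (G * kappa) F g dg Hs ltac:(lra)
    ltac:(nra) (fun p Hp => HdF' p ltac:(lra)) (fun p Hp => Hg p ltac:(lra))).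
  assert (HL := left_of_stationary_bound mu p1 p0 q eps s G F g dg Hmu Hs Heps
    ltac:(lra) ltac:(lra) HG (fun p Hp => HdF' p ltac:(lra)) (fun p Hp => Hg p ltac:(lra))
    (fun p Hp => Hdg p ltac:(lra))).
  assert (HN := near_singularity_bound mu p1 p2 M0 q F
    (fun p => U p * cis (- ((s * (p - p0)) ^ 2)))%C ltac:(lra) ltac:(lra)
    (fun p _ => HcF p) (fun p Hp => HdF p ltac:(lra))).
  assert (HR' := HR ltac:(intros p Hp; eapply Rle_trans; [ apply Hdg; lra | ];
    apply Rmult_le_compat_l; [ exact HG | apply Rpower_antitone; lra ])). clear HR.
  assert (HN' := HN ltac:(intros p Hp; simpl; rewrite Cmod_mult, Cmod_cis, Rmult_1_r; auto)).
  clear HN.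
  rewrite Rminus_diag, Rmult_0_r, fresnel_0 in HR', HL.
  fold kappa in HL.
  assert (Hg2 : g p2 = 0%C) by (unfold g; rewrite HU2; ring).
  rewrite Hg2 in HR'.
  set (w := (g q * ((fresnel (s * (q - p0)) - - fresnel_C_lim) * RtoC (/ s)))%C) in *.
  assert (Hi : 0 < / s) by now apply Rinv_0_lt_compat.
  assert (Hrq := Rpower_pos (q - p1) (mu - 1)).
  (* Boundary term at the cut: p0 - q >= eps / 2 makes the Fresnel tail at most 64 / (eps s). *)
  assert (Hw : Cmod w <= 64 * M0 / eps * (Rpower (q - p1) (mu - 1) / s ^ 2)).
  { assert (Hx : s * (q - p0) <= 0) by nra.
    assert (He := fresnel_tail_left _ Hx).
    replace (1 - s * (q - p0)) with (1 + s * (p0 - q)) in He by ring.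
    assert (Hy : 0 < s * (eps / 2)) by (apply Rmult_lt_0_compat; lra).
    assert (Hle : 32 / (1 + s * (p0 - q)) <= 32 / (s * (eps / 2))).
    { apply Rmult_le_compat_l; [ lra | ]. apply Rinv_le_contravar; [ exact Hy | nra ]. }
    unfold w, g. rewrite !Cmod_mult, !Cmod_R. rewrite !Rabs_pos_eq by lra.
    replace (64 * M0 / eps * (Rpower (q - p1) (mu - 1) / s ^ 2)) with
      (Rpower (q - p1) (mu - 1) * M0 * (32 / (s * (eps / 2)) * / s)) by (field; lra).
    apply Rmult_le_compat.
    - apply Rmult_le_pos; [ lra | apply Cmod_ge_0 ].
    - apply Rmult_le_pos; [ apply Cmod_ge_0 | lra ].
    - apply Rmult_le_compat_l; [ lra | apply HM0; lra ].
    - apply Rmult_le_compat_r; [ lra | ]. eapply Rle_trans; eassumption. }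
  match goal with |- Cmod ?z <= _ => set (total := z) end.
  match type of HR' with Cmod ?z <= _ => set (zr := z) in * end.
  match type of HL with Cmod ?z <= _ => set (zl := z) in * end.
  set (zn := (F q - F p1)%C) in *.
  (* The values of [F] at p0 and q telescope. At p0 each one-sided corrector contributes a g(p0) /
     s, which adds up to the leading term. *)
  assert (E : total = (zr + (zl + (zn - w)))%C) by (unfold total, zr, zl, zn, g; ring).
  assert (Htri : Cmod total <= Cmod zr + (Cmod zl + (Cmod zn + Cmod w))).
  { rewrite E. eapply Rle_trans; [ apply Cmod_triangle | apply Rplus_le_compat_l ].
    eapply Rle_trans; [ apply Cmod_triangle | apply Rplus_le_compat_l ].
    unfold Cminus. eapply Rle_trans; [ apply Cmod_triangle | ]. rewrite Cmod_opp. lra. }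
  (* Both logarithms are replaced by the one for the full length p2 - p1, which removes the
     dependence on p0 and q and turns 32 into 64. *)
  assert (Hln : forall L, 0 <= L <= p2 - p1 ->
     32 * (G * kappa) / s ^ 2 * ln (1 + s * L)
     <= 32 * (G * kappa) / s ^ 2 * ln (1 + s * (p2 - p1))).
  { intros L HL'. apply Rmult_le_compat_l.
    - apply Rdiv_le_0_compat; [ | exact Hs2 ]. apply Rmult_le_pos; [ lra | nra ].
    - apply Rcomplements.ln_le; nra. }
  assert (HlnR := Hln (p2 - p0) ltac:(lra)). assert (HlnL := Hln (p0 - q) ltac:(lra)).
  replace (64 * G / (eps * (1 - mu) * s ^ 2) * Rpower (q - p1) (mu - 1)) with
    (64 * G / (eps * (1 - mu)) * (Rpower (q - p1) (mu - 1) / s ^ 2)) in HL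
    by (field; repeat split; lra).
  replace (64 * (G * kappa) / s ^ 2 * ln (1 + s * (p2 - p1))) with
    (2 * (32 * (G * kappa) / s ^ 2 * ln (1 + s * (p2 - p1)))) by (field; lra).
  lra.
Qed.

(** * Constants independent of time and position *)

(** For s >= 1, 1 + s D <= (1 + D) s, and ln x <= x^al / al. The exponent al = 2 (1 - delta) is the
    one with s^al / s^2 = (s^2)^(-delta). *)
Lemma log_bound (delta D s : R) :
  1 / 2 < delta < 1 -> 0 <= D -> 1 <= s ->
  ln (1 + s * D) / s ^ 2
  <= Rpower (1 + D) (2 * (1 - delta)) / (2 * (1 - delta)) * Rpower (s ^ 2) (- delta).
Proof.
  intros Hd HD Hs. set (al := 2 * (1 - delta)).
  assert (Hal : 0 < al) by (unfold al; lra).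
  assert (Hs2 : 0 < s ^ 2) by (apply pow_lt; lra).
  assert (H1 : ln (1 + s * D) <= Rpower (1 + D) al / al * Rpower s al).
  { apply Rle_trans with (ln ((1 + D) * s)).
    - apply Rcomplements.ln_le; nra.
    - eapply Rle_trans; [ apply (ln_le_Rpower _ al); nra | ].
      rewrite <- Rpower_mult_distr by lra. right. unfold Rdiv. ring. }
  replace (Rpower (s ^ 2) (- delta)) with (Rpower s al / s ^ 2).
  2:{ rewrite <- !Rpower_pow by lra. rewrite Rpower_mult. unfold Rdiv.
      rewrite <- Rpower_Ropp, <- Rpower_plus. f_equal. unfold al. simpl. ring. }
  apply Rle_trans with (Rpower (1 + D) al / al * Rpower s al / s ^ 2).
  - apply Rmult_le_compat_r; [ left; now apply Rinv_0_lt_compat | exact H1 ].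
  - right. unfold Rdiv. ring.
Qed.

Lemma Rpower_inv_base (x y : R) : 0 < x -> Rpower (/ x) y = Rpower x (- y).
Proof. intros Hx. unfold Rpower. rewrite ln_Rinv by exact Hx. f_equal. ring. Qed.

Lemma Rpower_minus_2 (x : R) : 0 < x -> Rpower x (- 2) = / x * / x.
Proof.
  intros Hx. replace (- 2) with (- (1 + 1)) by ring. rewrite Rpower_Ropp.
  rewrite Rpower_plus, Rpower_1 by exact Hx. apply Rinv_mult.
Qed.

(** With y = T / s^2 >= 1, the right-hand sides are y^2, and (1 / s)^2 <= y <= y^2. This puts a
    bounded integral and a leading term of size 1 / s under t^(-2). *)
Lemma small_time_bound (T s : R) :
  1 <= T -> 0 < s -> s ^ 2 <= T ->
  1 <= T ^ 2 * Rpower (s ^ 2) (- 2) /\ / s <= T ^ 2 * Rpower (s ^ 2) (- 2).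
Proof.
  intros HT Hs Hle. assert (Hs2 : 0 < s ^ 2) by (apply pow_lt; lra).
  rewrite Rpower_minus_2 by exact Hs2.
  set (y := T * / s ^ 2). replace (T ^ 2 * (/ s ^ 2 * / s ^ 2)) with (y * y)
    by (unfold y; ring).
  assert (Hi : 0 < / s ^ 2) by now apply Rinv_0_lt_compat.
  assert (Hy : 1 <= y).
  { unfold y. rewrite <- (Rinv_r (s ^ 2)) by lra. apply Rmult_le_compat_r; lra. }
  assert (Hy2 : / s * / s <= y).
  { unfold y. replace (/ s * / s) with (/ s ^ 2) by (field; lra). nra. }
  split; [ nra | ]. apply Rle_trans with y; nra.
Qed.

(** The constants are fixed before s, p0 and [F]; this order is the uniformity in (t, x). *)
Lemma oscillatory_integral_estimate (mu p1 p2 eps delta : R) (U dU : R -> C) :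
  0 < mu < 1 -> p1 < p2 -> 0 < eps -> 1 / 2 < delta < 1 ->
  (forall p, is_Cderive U p (dU p)) -> (forall p, Ccontinuity_pt dU p) ->
  U p2 = 0%C ->
  exists K1 K2 K3 : R, 0 <= K1 /\ 0 <= K2 /\ 0 <= K3 /\
  forall s p0 (F : R -> C), 0 < s -> p1 + eps < p0 < p2 ->
  (forall p, Ccontinuity_pt F p) ->
  (forall p, p1 < p -> is_Cderive F p
       (RtoC (Rpower (p - p1) (mu - 1)) * (U p * cis (- ((s * (p - p0)) ^ 2))))%C) ->
  Cmod ((F p2 - F p1)
        - 2 * fresnel_C_lim * (RtoC (Rpower (p0 - p1) (mu - 1)) * U p0) * RtoC (/ s))%C
  <= K1 * Rpower (s ^ 2) (- mu) + K2 * Rpower (s ^ 2) (- 2) + K3 * Rpower (s ^ 2) (- delta).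
Proof.
  intros Hmu Hp12 Heps Hdelta HU HdU HU2.
  destruct (Ccontinuous_bounded U p1 p2) as [M0 [HM0p HM0]]; [ lra | | ].
  { intros p _. eapply is_Cderive_continuity_pt, HU. }
  destruct (Ccontinuous_bounded dU p1 p2) as [M1 [HM1p HM1]]; [ lra | auto | ].
  set (G := M0 + M1 * (p2 - p1)).
  assert (HG : 0 <= G) by (unfold G; nra).
  set (kappa := Rpower (eps / 2) (mu - 2)).
  assert (Hkap : 0 < kappa) by apply Rpower_pos.
  (* Threshold between the regimes: t >= 2 / eps puts the cut within eps / 2 of p1, and t >= 1 is
     what [log_bound] asks. *)
  set (T := Rmax 1 (2 / eps)).
  assert (HT1 : 1 <= T) by apply Rmax_l. assert (HT2 : 2 / eps <= T) by apply Rmax_r.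
  set (L := Rpower (1 + (p2 - p1)) (2 * (1 - delta)) / (2 * (1 - delta))).
  assert (HL : 0 <= L).
  { apply Rdiv_le_0_compat; [ left; apply Rpower_pos | lra ]. }
  set (V := power_primitive mu (p2 - p1)).
  assert (HV : 0 <= V).
  { unfold V. rewrite power_primitive_pos by lra.
    apply Rdiv_le_0_compat; [ left; apply Rpower_pos | lra ]. }
  set (re := Rpower eps (mu - 1)).
  assert (Hre : 0 < re) by apply Rpower_pos.
  set (c1 := 64 * G / (eps * (1 - mu)) + 64 * M0 / eps).
  assert (Hc1 : 0 <= c1).
  { apply Rplus_le_le_0_compat; apply Rdiv_le_0_compat; try lra.
    apply Rmult_lt_0_compat; lra. }
  assert (HMV : 0 <= M0 * V) by now apply Rmult_le_pos.
  assert (HMr : 0 <= M0 * re) by (apply Rmult_le_pos; lra).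
  assert (HMm : 0 <= M0 / mu) by (apply Rdiv_le_0_compat; lra).
  assert (HGk : 0 <= G * kappa) by (apply Rmult_le_pos; lra).
  (* First constant: g' near p1 and boundary term at the cut ([c1]), then the part left of the cut.
     Second: size of the integral and of the leading term, for small t; the 4 is 2 times the bound 2
     on |a|. Third: the logarithm. *)
  exists (c1 + M0 / mu), ((M0 * V + 4 * (M0 * re)) * T ^ 2), (64 * (G * kappa) * L).
  split; [ lra | ]. split; [ apply Rmult_le_pos; [ lra | apply pow2_ge_0 ] | ].
  split; [ apply Rmult_le_pos; lra | ].
  intros s p0 F Hs Hp0 HcF HdF.
  assert (Hs2 : 0 < s ^ 2) by (apply pow_lt; lra).
  assert (Hi2 : 0 < / s ^ 2) by now apply Rinv_0_lt_compat.
  assert (P1 := Rpower_pos (s ^ 2) (- mu)). assert (P2 := Rpower_pos (s ^ 2) (- 2)).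
  assert (P3 := Rpower_pos (s ^ 2) (- delta)).
  (* For [T <= t] the cut [p1 + 1 / t] stays at distance [eps / 2] from [p0]. *)
  destruct (Rle_lt_dec T (s ^ 2)) as [Hbig|Hsmall].
  - assert (Hq : / s ^ 2 <= eps / 2).
    { replace (eps / 2) with (/ (2 / eps)) by (field; lra).
      apply Rinv_le_contravar; [ apply Rdiv_lt_0_compat; lra | lra ]. }
    assert (H := stationary_phase_bound mu p1 p2 p0 (p1 + / s ^ 2) eps s M0 M1 U dU F
      Hmu Hs Heps ltac:(lra) Hp0 HU HM0 HM1 HU2 HcF HdF).
    cbv zeta in H. fold G kappa in H. fold c1 in H.
    eapply Rle_trans; [ exact H | ]. clear H.
    replace (p1 + / s ^ 2 - p1) with (/ s ^ 2) by ring.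
    (* With q - p1 = 1 / t, the boundary and discarded contributions are both multiples of
       t^(-mu). *)
    assert (E1 : Rpower (/ s ^ 2) (mu - 1) / s ^ 2 = Rpower (s ^ 2) (- mu)).
    { rewrite Rpower_inv_base by exact Hs2.
      replace (- mu) with (- (mu - 1) + - (1)) by ring.
      rewrite Rpower_plus, (Rpower_Ropp _ 1), Rpower_1 by exact Hs2. reflexivity. }
    assert (E2 : power_primitive mu (/ s ^ 2) = Rpower (s ^ 2) (- mu) / mu).
    { rewrite power_primitive_pos by exact Hi2.
      now rewrite Rpower_inv_base by exact Hs2. }
    rewrite E1, E2.
    assert (HD := log_bound delta (p2 - p1) s Hdelta ltac:(lra) ltac:(nra)). fold L in HD.
    assert (HD' : 64 * (G * kappa) / s ^ 2 * ln (1 + s * (p2 - p1))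
                  <= 64 * (G * kappa) * L * Rpower (s ^ 2) (- delta)).
    { replace (64 * (G * kappa) / s ^ 2 * ln (1 + s * (p2 - p1))) with
        (64 * (G * kappa) * (ln (1 + s * (p2 - p1)) / s ^ 2)) by (field; lra).
      rewrite (Rmult_assoc _ L). apply Rmult_le_compat_l; [ lra | exact HD ]. }
    replace (M0 * (Rpower (s ^ 2) (- mu) / mu)) with (M0 / mu * Rpower (s ^ 2) (- mu))
      by (field; lra).
    assert (0 <= (M0 * V + 4 * (M0 * re)) * T ^ 2 * Rpower (s ^ 2) (- 2)).
    { apply Rmult_le_pos; [ | lra ]. apply Rmult_le_pos; [ lra | apply pow2_ge_0 ]. }
    lra.
  - destruct (small_time_bound T s HT1 Hs ltac:(lra)) as [S1 S2].
    assert (Hi : 0 < / s) by now apply Rinv_0_lt_compat.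
    assert (HF := near_singularity_bound mu p1 p2 M0 p2 F
      (fun p => U p * cis (- ((s * (p - p0)) ^ 2)))%C ltac:(lra) ltac:(lra)
      (fun p _ => HcF p) (fun p Hp => HdF p ltac:(lra))
      ltac:(intros p Hp; simpl; rewrite Cmod_mult, Cmod_cis, Rmult_1_r; auto)).
    fold V in HF.
    assert (Hlead : Cmod (2 * fresnel_C_lim * (RtoC (Rpower (p0 - p1) (mu - 1)) * U p0)
                          * RtoC (/ s))%C <= 4 * (M0 * re) * / s).
    { assert (Hr0 := Rpower_pos (p0 - p1) (mu - 1)).
      assert (Hr : Rpower (p0 - p1) (mu - 1) <= re) by (apply Rpower_antitone; lra).
      rewrite !Cmod_mult, !Cmod_R. rewrite !Rabs_pos_eq by lra.
      apply Rmult_le_compat_r; [ lra | ].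
      replace (4 * (M0 * re)) with (2 * 2 * (re * M0)) by ring.
      assert (HU0 := Cmod_ge_0 (U p0)).
      apply Rmult_le_compat.
      - apply Rmult_le_pos; [ lra | apply Cmod_ge_0 ].
      - apply Rmult_le_pos; lra.
      - apply Rmult_le_compat_l; [ lra | apply fresnel_C_lim_bound ].
      - apply Rmult_le_compat; try lra. apply HM0. lra. }
    assert (A1 : M0 * V * 1 <= M0 * V * (T ^ 2 * Rpower (s ^ 2) (- 2)))
      by now apply Rmult_le_compat_l.
    assert (A2 : 4 * (M0 * re) * / s <= 4 * (M0 * re) * (T ^ 2 * Rpower (s ^ 2) (- 2)))
      by (apply Rmult_le_compat_l; [ lra | exact S2 ]).
    assert (A3 : 0 <= (c1 + M0 / mu) * Rpower (s ^ 2) (- mu)) by (apply Rmult_le_pos; lra).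
    assert (A4 : 0 <= 64 * (G * kappa) * L * Rpower (s ^ 2) (- delta)).
    { apply Rmult_le_pos; [ | lra ]. apply Rmult_le_pos; lra. }
    unfold Cminus at 1. eapply Rle_trans; [ apply Cmod_triangle | ]. rewrite Cmod_opp. lra.
Qed.

(** * Application to the Schroedinger solution *)

Lemma cis_plus (a b : R) : cis (a + b) = (cis a * cis b)%C.
Proof.
  unfold cis, Cmult; simpl. rewrite cos_plus, sin_plus. f_equal. ring.
Qed.

(** Completing the square in p. *)
Lemma schrodinger_phase_split (t x p : R) :
  0 < t ->
  cis (- (t * p ^ 2) + x * p)
  = (cis (x ^ 2 / (4 * t)) * cis (- ((sqrt t * (p - x / (2 * t))) ^ 2)))%C.
Proof.
  intros Ht. rewrite <- cis_plus. f_equal.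
  rewrite Rpow_mult_distr, <- (Rsqr_pow2 (sqrt t)), Rsqr_sqrt by lra. field. lra.
Qed.

(** Only values inside (p1, p2) enter the improper integral, where [v] is given by the formula and
    [ut] may be replaced by its extension [U]; continuity of [F] supplies the endpoint values. *)
Lemma schrodinger_solution_antiderivative
  (mu p1 p2 t x : R) (v ut U dU F : R -> C) :
  0 < mu -> p1 < p2 -> 0 < t ->
  (forall p, p1 < p < p2 -> v p = (RtoC (Rpower (p - p1) (mu - 1)) * ut p)%C) ->
  (forall p, p1 <= p <= p2 -> U p = ut p) ->
  (forall p, is_Cderive U p (dU p)) ->
  (forall p, Ccontinuity_pt F p) ->
  (forall p, p1 < p -> is_Cderive F p
       (RtoC (Rpower (p - p1) (mu - 1))
        * (U p * cis (- ((sqrt t * (p - x / (2 * t))) ^ 2))))%C) ->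
  schrodinger_solution p1 p2 v t x
  = (RtoC (/ (2 * PI)) * (cis (x ^ 2 / (4 * t)) * (F p2 - F p1)))%C.
Proof.
  intros Hmu Hp12 Ht Hv Hut HU HcF HdF. unfold schrodinger_solution. f_equal.
  set (e := cis (x ^ 2 / (4 * t))).
  rewrite (CInt_derive _ (fun p => e * (RtoC (Rpower (p - p1) (mu - 1))
        * (U p * cis (- ((sqrt t * (p - x / (2 * t))) ^ 2)))))%C (fun p => e * F p)%C p1 p2);
    [ ring | exact Hp12 | | | | | ].
  - apply (Ccontinuity_pt_mult (fun _ => e) F); [ | apply HcF ].
    eapply is_Cderive_continuity_pt, is_Cderive_const.
  - apply (Ccontinuity_pt_mult (fun _ => e) F); [ | apply HcF ].
    eapply is_Cderive_continuity_pt, is_Cderive_const.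
  - intros p Hp.
    assert (H := is_Cderive_mult _ _ _ _ _ (is_Cderive_const e p) (HdF p ltac:(lra))).
    match type of H with is_Cderive _ _ ?l =>
      match goal with |- is_Cderive _ _ ?l' => replace l' with l by ring end end.
    exact H.
  - intros p Hp.
    apply (Ccontinuity_pt_mult (fun _ => e) (fun p => RtoC (Rpower (p - p1) (mu - 1))
        * (U p * cis (- ((sqrt t * (p - x / (2 * t))) ^ 2))))%C).
    { eapply is_Cderive_continuity_pt, is_Cderive_const. }
    apply (Ccontinuity_pt_mult (fun p => RtoC (Rpower (p - p1) (mu - 1)))
      (fun p => U p * cis (- ((sqrt t * (p - x / (2 * t))) ^ 2)))%C).
    + apply (Ccontinuity_pt_RtoC (fun p => Rpower (p - p1) (mu - 1))).
      eapply is_derive_continuity_pt, is_derive_Rpower_shift. lra.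
    + eapply is_Cderive_continuity_pt, is_Cderive_oscillating, HU.
  - intros p Hp. rewrite Hv, Hut by lra. rewrite schrodinger_phase_split by exact Ht.
    fold e. ring.
Qed.

(** The constants match because the jump 2 a has modulus sqrt PI and sqrt PI / (2 PI) = 1 / (2 sqrt
    PI). *)
Lemma H_lead_stationary (p1 mu t x : R) (ut U : R -> C) :
  0 < t -> U (x / (2 * t)) = ut (x / (2 * t)) ->
  (H_lead p1 mu ut t x * RtoC (Rpower t (- (1 / 2))))%C
  = (RtoC (/ (2 * PI)) * (cis (x ^ 2 / (4 * t))
      * (2 * fresnel_C_lim
         * (RtoC (Rpower (x / (2 * t) - p1) (mu - 1)) * U (x / (2 * t))%R)
         * RtoC (/ sqrt t))))%C.
Proof.
  intros Ht HU. assert (HPI := PI_RGT_0).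
  assert (HsP : 0 < sqrt PI) by now apply sqrt_lt_R0.
  assert (Hpow : Rpower t (- (1 / 2)) = / sqrt t).
  { rewrite Rpower_Ropp. f_equal. replace (1 / 2) with (/ 2) by field.
    now apply Rpower_sqrt. }
  assert (Hc : (RtoC (/ (2 * PI)) * RtoC (sqrt PI))%C = RtoC (/ (2 * sqrt PI))).
  { rewrite <- RtoC_mult. f_equal. rewrite <- (sqrt_sqrt PI) at 1 by lra. field. lra. }
  unfold H_lead. rewrite fresnel_C_lim_polar, HU, Hpow, <- Hc. ring.
Qed.

Theorem theorem0p3 :
  forall (mu p1 p2 : R) (u0 : (R -> C) -> C) (v ut : R -> C),
    1 / 2 < mu < 1 ->
    p1 < p2 ->
    tempered_distribution u0 ->
    condition_C p1 p2 mu u0 v ut ->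
    forall eps : R, 0 < eps -> p1 + eps < p2 ->
    forall delta : R, 1 / 2 < delta < 1 ->
      MaxRlist (map Ropp (sigmas mu delta)) < - (1 / 2) /\
      exists K : nat -> R,
        (forall k : nat, (1 <= k <= 9)%nat -> 0 <= K k) /\
        (forall t x : R,
           0 < t ->
           2 * (p1 + eps) < x / t < 2 * p2 ->
           Cmod (schrodinger_solution p1 p2 v t x
                 - H_lead p1 mu ut t x * RtoC (Rpower t (- (1 / 2))))%C
           <= sum_f 1 9 (fun k => K k * Rpower t (- sigma_nth mu delta k))).
Proof.
  intros mu p1 p2 u0 v ut Hmu Hp12 _ [_ [Hv [Hut1 [_ Hut2]]]] eps Heps _ delta Hdelta.
  split.
  { simpl. repeat apply Rmax_lub_lt; lra. }
  destruct (C1_on_extension p1 p2 ut Hp12 Hut1) as [U [dU [HU [HdU HUut]]]].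
  assert (HU2 : U p2 = 0%C) by (rewrite HUut by lra; exact Hut2).
  destruct (oscillatory_integral_estimate mu p1 p2 eps delta U dU ltac:(lra) Hp12 Heps
    Hdelta HU HdU HU2) as [K1 [K2 [K3 [HK1 [HK2 [HK3 HK]]]]]].
  (* The three powers obtained are those of sigma_1 = mu, sigma_4 = 2 and sigma_5 = delta; the
     remaining constants are taken to be 0. *)
  exists (fun k => match k with 1%nat => K1 | 4%nat => K2 | 5%nat => K3 | _ => 0 end).
  split.
  { intros k _. do 6 (destruct k as [|k]; [ lra | ]). lra. }
  intros t x Ht Hx. set (p0 := x / (2 * t)).
  assert (Hp0 : p1 + eps < p0 < p2).
  { replace (x / t) with (2 * p0) in Hx by (unfold p0; field; lra). lra. }
  assert (Hs : 0 < sqrt t) by now apply sqrt_lt_R0.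
  destruct (oscillating_antiderivative mu p1 (sqrt t) p0 U dU ltac:(lra) HU HdU)
    as [F [HcF HdF]].
  rewrite (schrodinger_solution_antiderivative mu p1 p2 t x v ut U dU F) by (auto; lra).
  rewrite (H_lead_stationary p1 mu t x ut U Ht) by (apply HUut; fold p0; lra).
  fold p0.
  assert (Hbound := HK (sqrt t) p0 F Hs Hp0 HcF HdF).
  (* Turns the powers of s^2 into powers of t. *)
  rewrite <- (Rsqr_pow2 (sqrt t)), Rsqr_sqrt in Hbound by lra.
  match type of Hbound with Cmod ?z <= _ => set (err := z) in * end.
  match goal with |- Cmod ?z <= _ => replace z with
    (RtoC (/ (2 * PI)) * cis (x ^ 2 / (4 * t)) * err)%C by (unfold err; ring) end.
  (* The common prefactor has modulus 1 / (2 PI) <= 1 and is simply discarded. *)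
  assert (HPI : 0 < / (2 * PI) <= 1).
  { assert (H := PI2_3_2). split; [ apply Rinv_0_lt_compat; lra | ].
    rewrite <- Rinv_1. apply Rinv_le_contravar; lra. }
  rewrite !Cmod_mult, Cmod_R, Cmod_cis, Rmult_1_r, Rabs_pos_eq by lra.
  apply Rle_trans with (Cmod err).
  { assert (H := Cmod_ge_0 err). nra. }
  eapply Rle_trans; [ exact Hbound | ].
  right. unfold sum_f, sigma_nth. simpl. replace (Ropp 2) with (-2) by lra. lra.
Qed.
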